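(* Let $\Sigma \subset \mathbb{C}$ be compact, symmetric about the real axis, with $c(\Sigma)>0$. Let $\{\alpha_n\}$ be a sequence in $\overline{\mathbb{Q}}$, and write $b_n := b_{\alpha_n}$, such that $\deg\alpha_n\to\infty$, the sequence $\{h_\Sigma(\alpha_n)\}$ converges (to a finite limit), and the sequence $\{\log|b_n|/\deg\alpha_n\}$ converges. Let $$\mu_n := \frac{1}{\deg\alpha_n}\sum_{x\in\mathrm{Conj}(\alpha_n)} \delta_x,$$ and suppose that $\mu_n$ converges in the weak* topology to a probability measure $\mu$ on $\mathbb{C}$. Then for every nonconstant polynomial $Q\in\mathbb{Z}[z]$, $$\frac{1}{\deg Q}\int \log|Q(z)|\,d\mu(z) \ \geq\ -\lim_{n\to\infty}\frac{\log|b_n|}{\deg\alpha_n} - \mathcal{E}(\Sigma;\{\alpha_n\}).$$ Furthermore, $$I(\mu) \leq 2\Big(\lim_{n\to\infty}\frac{\log|b_n|}{\deg\alpha_n} + \mathcal{E}(\Sigma;\{\alpha_n\})\Big).$$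
   Context: For a positive Borel measure $\mu$ on $\mathbb{C}$, the logarithmic energy is $I(\mu) = \iint \log\frac{1}{|z-w|}\,d\mu(w)\,d\mu(z)$. For a compact set $K\subset\mathbb{C}$, the logarithmic capacity is $c(K) = \exp[-\inf\{I(\mu)\}]$, the infimum being over Borel probability measures $\mu$ supported in $K$. If $c(K)>0$ (i.e. $K$ is non-polar) there is a unique such measure $\mu_K$, the equilibrium measure of $K$, with $c(K) = \exp[-I(\mu_K)]$. The Green's function of $K$ with pole at $\infty$ is defined for all $z\in\mathbb{C}$ by $\mathrm{g}_K(z,\infty) = \int \log|z-w|\,d\mu_K(w) - \log c(K)$. For an algebraic number $\alpha \in \overline{\mathbb{Q}} \subset \mathbb{C}$, let $P_\alpha \in \mathbb{Z}[z]$ be the polynomial irreducible over the integers (hence primitive; unique up to sign) with $P_\alpha(\alpha)=0$; let $\deg\alpha = \deg P_\alpha$, let $b_\alpha$ be its leading coefficient, and let $\mathrm{Conj}(\alpha)$ be the set of all roots of $P_\alpha$ in $\mathbb{C}$. For a compact set $\Sigma$ with $c(\Sigma)>0$, the height of $\alpha$ with respect to $\Sigma$ is $$h_\Sigma(\alpha) = \frac{1}{\deg\alpha}\Big(\log|b_\alpha| + \sum_{x\in \mathrm{Conj}(\alpha)} \mathrm{g}_\Sigma(x,\infty)\Big).$$ The escape rate of a sequence $\{\beta_n\}$ in $\overline{\mathbb{Q}}$ with respect to $\Sigma$ is $$\mathcal{E}(\Sigma;\{\beta_n\}) = \lim_{r\to\infty}\Big(\liminf_{n\to\infty}\frac{1}{\deg\beta_n}\sum_{x\in\mathrm{Conj}(\beta_n),\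 |x|\geq r}\mathrm{g}_\Sigma(x,\infty)\Big);$$ it is a finite non-negative number when $\{h_\Sigma(\beta_n)\}$ is bounded. Under the hypotheses of the statement, it is known that $I(\mu)$ is finite and $\int\log^+|z|\,d\mu(z)<\infty$, so the integrals in the statement make sense. *)

(* Defs.v *)
From HB Require Import structures.
From mathcomp Require Import all_boot all_order all_algebra.
From mathcomp Require Import all_classical all_reals all_analysis.
From mathcomp.real_closed Require Import complex.

Set Implicit Arguments.
Unset Strict Implicit.
Unset Printing Implicit Defensive.

Import Order.TTheory GRing.Theory Num.Theory.
Import numFieldNormedType.Exports.

Local Open Scope classical_set_scope.
Local Open Scope ring_scope.

(* The topology of the plane: that of the numeric field [R[i]], induced by its
   norm. *)
#[non_forgetful_inheritance]
HB.instance Definition _ (R : realType) :=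
  NormedModule.copy R[i] (R[i] : numFieldType)^o.

(* The complex plane with its Borel sigma-algebra; its underlying type is
   [R[i]], so functions on [R[i]] can be integrated against measures on it. *)
Notation borelC R := (g_sigma_algebraType (@open R[i])).

(* The norm [`|z|] of [R[i]] is valued in [R[i]]; this is the modulus in [R]. *)
Notation modulus := ComplexField.Normc.normc.

Section Potential.
Variable R : realType.
Implicit Types (mu nu : {measure set (borelC R) -> \bar R}) (K : set R[i]).

(* log |z|, with log 0 = -oo *)
Definition logmod (z : R[i]) : \bar R := lne (modulus z)%:E.

(* The kernel log (1 / |z - w|) is written [- logmod (z - w)] and not
   [lne (modulus (z - w))^-1%:E], because [0^-1 = 0] in [R] would give it the
   value -oo instead of +oo on the diagonal. *)
Definition log_energy mu : \bar R :=
  (\int[mu]_z \int[mu]_w (- logmod ((z : R[i]) - w)%R))%E.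

Definition supported_in K mu : Prop := mu (~` K) = 0%E.

Definition capacity K : \bar R :=
  expeR (- ereal_inf [set log_energy mu |
                       mu in [set mu : probability (borelC R) R
                                | supported_in K mu]])%E.

Definition is_equilibrium K (nu : probability (borelC R) R) : Prop :=
  supported_in K nu /\ capacity K = expeR (- log_energy nu)%E.

(* [get] is a choice operator; the equilibrium measure exists and is unique
   for compact [K] with [(0 < capacity K)%E], the only case of interest. *)
Definition equilibrium_measure K : probability (borelC R) R :=
  get (is_equilibrium K).

Definition green K (z : R[i]) : \bar R :=
  (\int[equilibrium_measure K]_w logmod (z - w)%R - lne (capacity K))%E.

End Potential.

Section AlgebraicNumbers.
Variable R : realType.
Implicit Types a : R[i].

Definition algebraic_number a : Prop := algebraicOver (ratr : rat -> R[i]) a.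

(* Irreducible as an element of the ring Z[z], hence primitive when
   nonconstant; this is not [irreducible_poly], which ignores constant
   factors. *)
Definition irreducible_in_Zz (P : {poly int}) : Prop :=
  [/\ P != 0, P \isn't a GRing.unit
    & forall A B : {poly int}, P = A * B ->
        (A \is a GRing.unit) || (B \is a GRing.unit)].

Definition Croot (P : {poly int}) a : Prop :=
  root (map_poly (intr : int -> R[i]) P) a.

(* Unique up to sign for algebraic [a], whence the choice. *)
Definition intMinPoly a : {poly int} :=
  xget 0 [set P | irreducible_in_Zz P /\ Croot P a].

Definition adeg a : nat := (size (intMinPoly a)).-1.

Definition alead a : int := lead_coef (intMinPoly a).

Definition log_alead a : R := ln (`|alead a|%:~R).

Definition Conj a : set R[i] := [set x | Croot (intMinPoly a) x].

Definition height (Sigma : set R[i]) a : \bar R :=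
  (((adeg a)%:R^-1)%:E *
     ((log_alead a)%:E + \sum_(x \in Conj a) green Sigma x))%E.

Definition escape_rate (Sigma : set R[i]) (b : nat -> R[i]) : \bar R :=
  lim ((fun r : R => limn_einf (fun n => ((adeg (b n))%:R^-1)%:E *
          \sum_(x \in Conj (b n) `&` [set x | (r <= modulus x)%R])
             green Sigma x)%E) @ +oo).

Definition conj_seq a : seq R[i] := finmap.enum_fset (fset_set (Conj a)).

Definition conj_measure a : {measure set (borelC R) -> \bar R} :=
  mscale ((adeg a)%:R^-1)%:nng
    (msum (fun k => dirac ((conj_seq a)`_k : borelC R)) (size (conj_seq a))).

End AlgebraicNumbers.

(* Weak* convergence, tested on continuous functions with compact support. *)
Definition weak_star_cvg (R : realType)
    (m : nat -> {measure set (borelC R) -> \bar R})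
    (mu : {measure set (borelC R) -> \bar R}) : Prop :=
  forall f : R[i] -> R, continuous f ->
    compact (closure [set z | f z != 0]) ->
    (\int[m n]_z (f z)%:E)%E @[n --> \oo] --> (\int[mu]_z (f z)%:E)%E.

(* Main.v *)
Require Import Defs.
From HB Require Import structures.
From mathcomp Require Import all_boot all_order all_algebra.
From mathcomp Require Import all_classical all_reals all_analysis.
From mathcomp Require Import separable measurable_realfun zify ring lra.
From mathcomp.real_closed Require Import complex.
Import Order.TTheory GRing.Theory Num.Theory.
Import numFieldNormedType.Exports.
Local Open Scope classical_set_scope.
Local Open Scope ring_scope.

Set Implicit Arguments.
Unset Strict Implicit.
Unset Printing Implicit Defensive.

(* Put l(z) = log (1 + |z|) and u(z, w) = |z - w| / ((1 + |z|) (1 + |w|)), which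
   lies in [0, 1]. Then - log |z - w| = - log u(z, w) - l(z) - l(w), where
   - log u is nonnegative and so can be truncated to compactly supported
   continuous functions: its integrals are lower semicontinuous under weak*
   convergence. For the same reason - log |Q| is, up to a multiple of l and a
   constant, a nonnegative kernel, a sum of terms - log u(z, zeta) over the
   roots zeta of Q.
   Since the resultant of P_n and Q is a nonzero integer, the mean of - log |Q|
   under mu_n is at most deg Q log|b_n| / deg alpha_n; the resultant of P_n and
   P_n' similarly bounds the discrete energy of mu_n. What is left is the mass of
   l, which may escape to infinity: near infinity the Green function is at least
   l - C, so that liminf (int l dmu_n) <= int l dmu + E(Sigma; alpha_n). If the
   escape rate is infinite there is nothing to prove. *)

(** * Integrality of resultants *)

(** A constant error such as C would survive in the limit if it were paid on the whole mass of mu_n.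
    It is paid only outside a large disk, where mu_n has little mass because mu has total mass 1.
    The mean of l is controlled only for infinitely many n, since the escape rate involves a lower
    limit; the resultant bounds and the convergence of test integrals hold for all large n, so that
    all estimates can be evaluated along one subsequence. In both conclusions int l dmu then occurs
    on both sides with the same coefficient, deg Q or 2, and cancels, being finite as soon as the
    escape rate is. The truncated kernel is bounded, so the diagonal missing from the discriminant
    costs only O(1 / deg alpha_n). *)

(* The Sylvester matrix of [P] and [Q], multiplied by the block matrix whose
   first columns are the Vandermonde columns of the roots of [P] and whose last
   columns are unit vectors, becomes block triangular. *)
Lemma resultant_roots (F : numFieldType) (P Q : {poly int}) (rs : seq F) :
  map_poly intr P = (lead_coef P)%:~R *: \prod_(x <- rs) ('X - x%:P) ->
  P != 0 -> uniq rs ->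
  exists m : int,
    m%:~R = (lead_coef P)%:~R ^+ (size Q).-1
            * \prod_(x <- rs) (map_poly (intr : int -> F) Q).[x].
Proof.
move=> Pfact P0 rs_uniq; set q := (size Q).-1; set d := size rs.
have bF0 : (lead_coef P)%:~R != 0 :> F by rewrite intr_eq0 lead_coef_eq0.
have PF : size P = d.+1.
  have := congr1 (fun p : {poly F} => size p) Pfact.
  by rewrite size_map_inj_poly ?size_scale// ?size_prod_XsubC//; exact: intr_inj.
pose S : 'M[int]_(d + q) :=
  col_mx (\matrix_(i < d, j < d + q) (Q * 'X^i)`_j)
         (\matrix_(i < q, j < d + q) (P * 'X^i)`_j).
pose rv : 'rV[F]_d := \row_i rs`_i.
pose V := Vandermonde d rv.
pose W : 'M[F]_(q, d) := \matrix_(i, j) rs`_j ^+ (d + i).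
pose T : 'M[F]_(d + q) := block_mx V 0 W 1%:M.
pose U : 'M[F]_(q, q) := \matrix_(i, j) ((P * 'X^i)`_(d + j))%:~R.
pose U' : 'M[F]_(d, q) := \matrix_(i, j) ((Q * 'X^i)`_(d + j))%:~R.
pose qv : 'rV[F]_d := \row_i (map_poly intr Q).[rs`_i].
pose Z := \matrix_(i < d, j < d) ((map_poly intr Q).[rs`_j] * rs`_j ^+ i).
have evalE (A : {poly int}) (i : nat) (x : F) : (size (A * 'X^i)%R <= d + q)%N ->
    \sum_(k < d + q) ((A * 'X^i)`_k)%:~R * x ^+ k = (map_poly intr A).[x] * x ^+ i.
  move=> sA.
  rewrite -[RHS](_ : (map_poly intr (A * 'X^i)).[x] = _); last first.
    by rewrite rmorphM/= map_polyXn hornerM hornerXn.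
  rewrite (@horner_coef_wide _ (d + q)); last first.
    by rewrite size_map_inj_poly//; exact: intr_inj.
  by apply: eq_bigr => k _; rewrite coef_map.
have sizeQ (i : 'I_d) : (size (Q * 'X^i)%R <= d + q)%N.
  have [->|Q0] := eqVneq Q 0; first by rewrite mul0r size_poly0.
  rewrite size_Mmonic// ?monicXn// size_polyXn addnS/=.
  have sQ : size Q = q.+1 by rewrite prednK// size_poly_gt0.
  by rewrite sQ addSn -addnS addnC leq_add2r ltn_ord.
have sizeP (i : 'I_q) : (size (P * 'X^i)%R <= d + q)%N.
  rewrite size_Mmonic// ?monicXn// size_polyXn addnS/= PF.
  by rewrite addSn ltn_add2l ltn_ord.
have rootP_ (j : 'I_d) : (map_poly intr P).[rs`_j] = 0.
  rewrite Pfact hornerZ horner_prod (big_nth 0) big_mkord -/d.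
  by rewrite (bigD1 j)//= hornerXsubC subrr mul0r mulr0.
have vE k (j : 'I_d) : T k (lshift q j) = rs`_j ^+ k.
  by rewrite /T /block_mx; case: (split_ordP k) => k' ->;
    rewrite ?col_mxEu ?col_mxEd row_mxEl !mxE.
have wE k (j : 'I_q) : T k (rshift d j) = (k == rshift d j)%:R.
  rewrite /T /block_mx; case: (split_ordP k) => k' ->.
    by rewrite ?col_mxEu ?col_mxEd row_mxEr !mxE eq_lrshift.
  by rewrite ?col_mxEu ?col_mxEd row_mxEr !mxE eq_rshift.
have SuE i j : S (lshift q i) j = (Q * 'X^i)`_j by rewrite col_mxEu mxE.
have SdE i j : S (rshift d i) j = (P * 'X^i)`_j by rewrite col_mxEd mxE.
have ST : map_mx intr S *m T = block_mx Z U' 0 U.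
  apply/matrixP => i j; rewrite mxE.
  case: (split_ordP i) => i' ->; case: (split_ordP j) => j' ->.
  - rewrite block_mxEul mxE -evalE//.
    by apply: eq_bigr => k _; rewrite vE mxE SuE.
  - rewrite block_mxEur (bigD1 (rshift d j'))//= wE eqxx mulr1.
    rewrite big1 ?addr0 => [|k /negPf kj]; last by rewrite wE kj mulr0.
    by rewrite [RHS]mxE [LHS]mxE SuE.
  - transitivity ((map_poly intr P).[rs`_j'] * rs`_j' ^+ i'); last first.
      by rewrite rootP_ mul0r block_mxEdl mxE.
    rewrite -evalE//.
    by apply: eq_bigr => k _; rewrite vE mxE SdE.
  - rewrite block_mxEdr (bigD1 (rshift d j'))//= wE eqxx mulr1.
    rewrite big1 ?addr0 => [|k /negPf kj]; last by rewrite wE kj mulr0.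
    by rewrite [RHS]mxE [LHS]mxE SdE.
have ZE : Z = V *m diag_mx qv.
  by apply/matrixP => i j; rewrite mul_mx_diag !mxE mulrC.
have detU : \det U = (lead_coef P)%:~R ^+ q.
  rewrite det_trig.
    rewrite (eq_bigr (fun=> (lead_coef P)%:~R)) ?prodr_const ?card_ord// => i _.
    by rewrite mxE coefMXn ltnNge leq_addl/= addnK lead_coefE PF.
  apply/is_trig_mxP => i j ij; rewrite mxE coefMXn.
  rewrite ltnNge (leq_trans (ltnW ij)) ?leq_addl//= nth_default// PF.
  by rewrite -addnBA ?(ltnW ij)// -addn1 leq_add2l subn_gt0.
have detV : \det V != 0.
  rewrite det_Vandermonde; apply/prodf_neq0 => i _; apply/prodf_neq0 => j ij.
  by rewrite !mxE subr_eq0 nth_uniq ?ltn_ord// eq_sym ltn_eqF.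
have prE : \prod_(x <- rs) (map_poly (intr : int -> F) Q).[x] = \prod_(i < d) qv 0 i.
  by rewrite (big_nth 0) big_mkord; apply: eq_bigr => i _; rewrite mxE.
(* Taking determinants in [ST] puts the Vandermonde determinant on both sides. It cancels because
   the roots are distinct, and the determinant of the integer matrix [S] remains. *)
exists (\det S); apply: (mulIf detV).
have := congr1 determinant ST; rewrite det_mulmx det_lblock det_ublock ZE.
rewrite det_mulmx det_diag det1 mulr1 detU det_map_mx => ->.
by rewrite prE mulrC [\det V * _]mulrC mulrA.
Qed.

(* Gauss: over the rationals the common factor of [P] and [A] comes from an
   integral factor of [P]. *)
Lemma irreducible_size_le (F : numFieldType) (P A : {poly int}) (x : F) :
  irreducible_in_Zz P -> A != 0 ->
  root (map_poly intr P) x -> root (map_poly intr A) x -> (size P <= size A)%N.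
Proof.
case=> P0 _ Pirr A0 Px Ax.
pose f := map_poly (intr : int -> rat).
pose g := gcdp (f P) (f A).
have ratrE (B : {poly int}) : map_poly ratr (f B) = map_poly (intr : int -> F) B.
  by rewrite -map_poly_comp; apply: eq_map_poly => z /=; rewrite ratr_int.
have gx : root (map_poly (ratr : rat -> F) g) x.
  by rewrite /g gcdp_map root_gcd !ratrE Px.
have [P1 [a a0 gE] [r PE]] := dvdpP_rat_int (dvdp_gcdl (f P) (f A)).
have sg : size g = size P1 by rewrite /g gE size_scale// size_rat_int_poly.
have fA0 : f A != 0 by rewrite -size_poly_gt0 size_rat_int_poly size_poly_gt0.
have g0 : g != 0 by rewrite gcdp_eq0 negb_and fA0 orbT.
have gs : (size g > 1)%N.
  rewrite ltnNge; apply/negP => /size1_polyC gC; move: gx.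
  rewrite gC map_polyC rootC fmorph_eq0 => /eqP c0.
  by move: g0; rewrite gC c0 eqxx.
(* [P1] has the degree of [g], which is positive because [g] vanishes at [x]; so the cofactor [r] is
   the unit, and [g] has the full degree of [P]. *)
have := Pirr _ _ PE; case/orP => [|/andP[/eqP r1 _]].
  by move=> /andP[/eqP P1s _]; rewrite sg P1s in gs.
have <- : size g = size P.
  rewrite sg PE size_mul ?r1 ?addn1//; last by rewrite -size_poly_gt0 r1.
  by rewrite -size_poly_gt0 -sg ltnW.
rewrite -(size_rat_int_poly A) -/(f A).
by apply: dvdp_leq => //; exact: dvdp_gcdr.
Qed.

(** The roots are simple: a common root of [P] and its derivative would contradict
    [irreducible_size_le], since the derivative is nonzero of smaller degree. *)
Lemma irreducible_roots (F : numClosedFieldType) (P : {poly int}) :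
  irreducible_in_Zz P ->
  exists2 rs : seq F, uniq rs &
    map_poly intr P = (lead_coef P)%:~R *: \prod_(x <- rs) ('X - x%:P).
Proof.
move=> Pirr; have [P0 _ _] := Pirr.
have [rs rsE] := closed_field_poly_normal (map_poly (intr : int -> F) P).
have lE : lead_coef (map_poly (intr : int -> F) P) = (lead_coef P)%:~R.
  by rewrite lead_coef_map_inj//; exact: intr_inj.
rewrite lE in rsE; exists rs => //.
rewrite -separable_prod_XsubC.
have b0 : (lead_coef P)%:~R != 0 :> F by rewrite intr_eq0 lead_coef_eq0.
rewrite -(eqp_separable (eqp_scale _ b0)) -rsE.
rewrite unlock deriv_map; apply: Pdiv.ClosedField.root_coprimep => x Px.
have dP0 : P^`() != 0.
  apply/eqP => /polyP/(_ (size P).-2); rewrite coef_deriv coef0.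
  have sP : (1 < size P)%N.
    rewrite ltnNge; apply/negP => /size1_polyC PC; move: Px P0.
    by rewrite PC map_polyC rootC intr_eq0 polyC_eq0 => ->.
  rewrite -subn2 -subSn// subSS subn1 -/(lead_coef P) => /eqP.
  by rewrite mulrn_eq0 lead_coef_eq0 (negPf P0) orbF -subn1 subn_eq0 leqNgt sP.
apply/negP => dPx.
have := irreducible_size_le Pirr dP0 Px dPx.
by rewrite leqNgt lt_size_deriv.
Qed.

(** * The complex plane *)

Section ComplexPlane.
Variable R : realType.
Implicit Types z w : R[i].

Lemma modulus_ge0 z : 0 <= modulus z.
Proof. by case: z => a b; rewrite sqrtr_ge0. Qed.

Lemma modulus_dist z w : `|modulus z - modulus w| <= modulus (z - w).
Proof. exact: (@ler_dist_dist R (Rcomplex R) z w). Qed.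

Lemma modulusBC z w : modulus (z - w) = modulus (w - z).
Proof. by rewrite -(normcN (z - w)) opprB. Qed.

(** Balls of [R[i]] have radii in [R[i]], where 0 < e forces e to be real; this translates them into
    real radii. *)
Lemma nbhs_modulus z (A : set R[i]) :
  nbhs z A <-> exists2 e : R, 0 < e & forall w, modulus (z - w) < e -> A w.
Proof.
split=> [/nbhs_ballP[e e0 eA]|[e e0 eA]].
  have e0' : 0 < e by [].
  move: e0'; rewrite ltcE => /andP[/eqP ei er]; exists (complex.Re e) => // w zw.
  apply: eA; rewrite -ball_normE /=.
  by rewrite normc_def ltcE /= ei eqxx/=; case: (z - w) zw.
apply/nbhs_ballP; exists (e%:C)%C; first by rewrite /= ltcR.
move=> w; rewrite -ball_normE /= => zw; apply: eA.
by move: zw; rewrite normc_def ltcR; case: (z - w).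
Qed.

Lemma lipschitz_continuousC (f : R[i] -> R) (K : R) :
  (forall z w, `|f z - f w| <= K * modulus (z - w)) -> continuous f.
Proof.
move=> fK z A /nbhs_ballP[e e0 eA]; apply/nbhs_modulus; rewrite /= in e0.
have K0 : 0 < `|K| + 1 by rewrite ltr_wpDl.
exists (e / (`|K| + 1)); first by rewrite divr_gt0.
move=> w; rewrite ltr_pdivlMr// mulrC => zw; apply: eA; apply: le_lt_trans zw.
apply: (le_trans (fK z w)); rewrite ler_wpM2r ?modulus_ge0//.
by rewrite (le_trans (ler_norm K))// lerDl.
Qed.

Lemma continuous_modulus : continuous (fun z : R[i] => modulus z).
Proof.
by apply: (@lipschitz_continuousC _ 1) => z z'; rewrite mul1r modulus_dist.
Qed.

Lemma closed_disk (r : R) : closed [set z : R[i] | modulus z <= r].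
Proof.
rewrite (_ : [set z | _] = (fun z : R[i] => modulus z) @^-1` [set x | x <= r])//.
by apply: preimage_closed; [move=> z _; exact: continuous_modulus|exact: closed_le].
Qed.

Lemma modulus_le_ReIm (a b : R) : modulus (a +i* b)%C <= `|a| + `|b|.
Proof.
rewrite /= -[leRHS]ger0_norm ?addr_ge0// -sqrtr_sqr ler_sqrt ?sqr_ge0//.
rewrite sqrrD !real_normK ?num_real// addrAC lerDl.
by rewrite mulrn_wge0// mulr_ge0.
Qed.

Lemma compact_disk (r : R) : compact [set z : R[i] | modulus z <= r].
Proof.
pose c (p : R * R) : R[i] := (p.1 +i* p.2)%C.
have cc : continuous c.
  move=> p A /nbhs_modulus[e e0 eA].
  have : \forall q \near p, ball p (e / 2) q.
    by apply: nbhsx_ballx; rewrite divr_gt0.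
  apply: filterS => q [pq1 pq2]; apply: eA.
  apply: (le_lt_trans (modulus_le_ReIm (p.1 - q.1) (p.2 - q.2))).
  by rewrite (splitr e) ltrD.
apply: (@subclosed_compact _ _ (c @` (`[-r, r] `*` `[-r, r]))).
- exact: closed_disk.
- apply: continuous_compact; first exact: continuous_subspaceT.
  by apply: compact_setX; exact: segment_compact.
- move=> [a b] /= abr; exists (a, b) => //=; rewrite !in_itv/= -!ler_norml.
  split; apply: le_trans abr; rewrite -sqrtr_sqr ler_sqrt ?addr_ge0 ?sqr_ge0//.
    by rewrite lerDl sqr_ge0.
  by rewrite lerDr sqr_ge0.
Qed.

Lemma compact_bounded_modulus (K : set R[i]) :
  compact K -> exists rho : R, forall z, K z -> modulus z <= rho.
Proof.
move=> cK.
have /compact_bounded[M [_ MK]] : compact ((fun z : R[i] => modulus z) @` K).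
  by apply: continuous_compact cK; apply: continuous_subspaceT; exact: continuous_modulus.
exists (M + 1) => z Kz; rewrite (le_trans (ler_norm _))//.
by apply: MK; [rewrite ltrDl|exists z].
Qed.

Lemma continuous_measurableC (f : R[i] -> R) :
  continuous f -> measurable_fun [set: borelC R] (f : borelC R -> R).
Proof.
move=> cf; apply: (measurability _ (measurable_realfun.RGenOpens.measurableE R)).
move=> _ [_ [a [b ->] <-]]; rewrite setTI.
apply: sub_sigma_algebra; apply: open_comp; last exact: interval_open.
by move=> z _; exact: cf.
Qed.

End ComplexPlane.

(** * Averages, truncated logarithms and cutoffs *)

Section Average.
Variables (R : realType) (T : eqType).
Implicit Types (s : seq T) (f g : T -> R).

Definition avg s f : R := (size s)%:R^-1 * \sum_(x <- s) f x.

Lemma ler_avg s f g : {in s, forall x, f x <= g x} -> avg s f <= avg s g.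
Proof.
move=> fg; rewrite ler_wpM2l ?invr_ge0//.
by rewrite big_seq [leRHS]big_seq ler_sum.
Qed.

Lemma eq_avg s f g : {in s, f =1 g} -> avg s f = avg s g.
Proof.
move=> fg; rewrite /avg; congr (_ * _).
by rewrite big_seq [RHS]big_seq; exact: eq_bigr.
Qed.

Lemma avgD s f g : avg s (fun x => f x + g x) = avg s f + avg s g.
Proof. by rewrite /avg big_split mulrDr. Qed.

Lemma avgB s f g : avg s (fun x => f x - g x) = avg s f - avg s g.
Proof. by rewrite /avg sumrB mulrBr. Qed.

Lemma avgZ s k f : avg s (fun x => k * f x) = k * avg s f.
Proof. by rewrite /avg -mulr_sumr mulrCA. Qed.

Lemma avg_cst s c : s != [::] -> avg s (fun=> c) = c.
Proof.
move=> s0; rewrite /avg big_const_seq count_predT iter_addr addr0.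
by rewrite -[c *+ _]mulr_natl mulKf// pnatr_eq0 size_eq0.
Qed.

(** The empty list has average 0, so that, unlike the equality [avg_cst], this bound holds for every
    list. *)
Lemma avg_cst_le s c : 0 <= c -> avg s (fun=> c) <= c.
Proof.
by move=> c0; have [->|/avg_cst->//] := eqVneq s [::]; rewrite /avg big_nil mulr0.
Qed.

Lemma avg_dist_le s f g c : 0 <= c -> {in s, forall x, `|f x - g x| <= c} ->
  `|avg s f - avg s g| <= c.
Proof.
move=> c0 fgc; rewrite -avgB ler_norml; apply/andP; split.
  rewrite lerNl -mulN1r -avgZ (le_trans _ (avg_cst_le s c0))// ler_avg// => x xs.
  by rewrite mulN1r lerNl; have := fgc x xs; rewrite ler_norml => /andP[].
rewrite (le_trans _ (avg_cst_le s c0))// ler_avg// => x xs.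
by have := fgc x xs; rewrite ler_norml => /andP[].
Qed.

End Average.

Section LiminfLe.
Variable R : realType.
Implicit Types (a b : nat -> R) (c : R).

(* That is, [liminf a <= c]. *)
Definition liminf_le a c :=
  forall e, 0 < e -> forall N, exists2 n, (N <= n)%N & a n <= c + e.

(** The bound on [b] holds for all large n, hence also at the infinitely many n at which [a n] is
    close to [c]. In this way control of the mean of l along a subsequence passes to the logarithmic
    kernels. *)
Lemma liminf_le_affine a b (s : nat -> R) (K S c : R) : 0 <= K ->
  liminf_le a c -> s @ \oo --> S ->
  (\forall n \near \oo, b n <= K * a n + s n) -> liminf_le b (K * c + S).
Proof.
move=> K0 ac sS bas e e0 N.
have K10 : 0 < 2 * (K + 1) by rewrite mulr_gt0// ltr_wpDl.
have : \forall n \near \oo, s n <= S + e / 2.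
  by apply: (cvgr_le _ sS); rewrite ltrDl divr_gt0.
move=> /(filterI bas)[M _ HM].
have [n Nn an] := ac (e / (2 * (K + 1))) (divr_gt0 e0 K10) (maxn N M).
move: Nn; rewrite geq_max => /andP[Nn Mn]; exists n => //.
have [bn sn] := HM _ Mn; apply: (le_trans bn).
apply: (le_trans (lerD (ler_wpM2l K0 an) sn)).
rewrite mulrDr -!addrA lerD2l addrCA lerD2l.
rewrite [leRHS](splitr e) lerD2r mulrCA ler_pM2l// -[leRHS]mul1r.
by rewrite ler_pdivrMr// mulrA mul1r mulVf ?pnatr_eq0// mul1r lerDl.
Qed.

Lemma liminf_le_cvg a (b : nat -> R) (B c : R) :
  liminf_le a c -> b @ \oo --> B ->
  (\forall n \near \oo, b n <= a n) -> B <= c.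
Proof.
move=> ac bB ba; apply/ler_addgt0Pr => e e0.
rewrite (splitr e) addrA -lerBlDr.
have : \forall n \near \oo, B - e / 2 <= b n.
  by apply: (cvgr_ge _ bB); rewrite gtrDl oppr_lt0 divr_gt0.
move=> /(filterI ba)[M _ HM].
have e20 : 0 < e / 2 by rewrite divr_gt0.
have [n Mn an] := ac _ e20 M; have [bn Bn] := HM n Mn.
by rewrite (le_trans Bn)// (le_trans bn).
Qed.

End LiminfLe.

Section TruncatedLog.
Variable R : realType.
Implicit Types (x y : R) (k : nat).

Lemma ler_dist_maxl (c x y : R) : `|Num.max c x - Num.max c y| <= `|x - y|.
Proof.
have := ler_norm (x - y); have := ler_norm (y - x); rewrite (distrC y) => h1 h2.
by rewrite ler_norml; case: (leP c x) => ?; case: (leP c y) => ?; apply/andP; split; lra.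
Qed.

Lemma ler_dist_minl (c x y : R) : `|Num.min c x - Num.min c y| <= `|x - y|.
Proof.
have := ler_norm (x - y); have := ler_norm (y - x); rewrite (distrC y) => h1 h2.
by rewrite ler_norml; case: (leP c x) => ?; case: (leP c y) => ?; apply/andP; split; lra.
Qed.

(** This is min (- log x, k). Truncating inside the logarithm gives the value k at x = 0, where [ln]
    has a default value, and makes the function Lipschitz. *)
Definition tlog k x : R := - ln (Num.max x (expR (- k%:R))).

Let max_gt0 k x : 0 < Num.max x (expR (- k%:R)).
Proof. by rewrite lt_max expR_gt0 orbT. Qed.

Lemma tlog_ge0 k x : x <= 1 -> 0 <= tlog k x.
Proof.
move=> x1; rewrite oppr_ge0 ln_le0// ge_max x1/= -[leRHS]expR0.
by rewrite ler_expR oppr_le0.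
Qed.

Lemma tlog_le k x : tlog k x <= k%:R.
Proof.
by rewrite lerNl -[leLHS]expRK ler_ln ?posrE ?expR_gt0// le_max lexx orbT.
Qed.

Lemma tlog_homo x : {homo tlog^~ x : m n / (m <= n)%N >-> m <= n}.
Proof.
move=> m n mn; rewrite lerN2 ler_ln ?posrE//.
by rewrite ge_max !le_max lexx/= ler_expR lerN2 ler_nat mn orbT.
Qed.

Lemma tlog_le_ln k x : 0 < x -> tlog k x <= - ln x.
Proof. by move=> x0; rewrite lerN2 ler_ln ?posrE// le_max lexx. Qed.

(** The slope of log on [e^(-k), +oo) is at most e^k; concretely, log (a / b) <= (a - b) / b with b
    >= e^(-k). *)
Lemma tlog_lip k x y : `|tlog k x - tlog k y| <= expR k%:R * `|x - y|.
Proof.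
wlog xy : x y / x <= y => [H|].
  have [|/ltW yx] := leP x y; first exact: H.
  by rewrite distrC (distrC x); exact: H.
rewrite (distrC x) (@ger0_norm _ (y - x)) ?subr_ge0//.
rewrite ger0_norm; last first.
  rewrite subr_ge0 lerN2 ler_ln ?posrE//.
  by rewrite ge_max !le_max xy lexx orbT.
rewrite /tlog opprK addrC; set a := Num.max y _; set b := Num.max x _.
have b0 : 0 < b by exact: max_gt0.
rewrite -ln_div ?posrE//; last exact: max_gt0.
have -> : a / b = 1 + (a - b) / b by rewrite mulrBl divff ?gt_eqF// addrC subrK.
have ab : a - b <= y - x.
  rewrite /a /b ![Num.max _ (expR _)]maxC (le_trans (ler_norm _))//.
  by rewrite (le_trans (ler_dist_maxl _ _ _))// ger0_norm// subr_ge0.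
have ab0 : 0 <= a - b.
  by rewrite subr_ge0 ge_max !le_max xy lexx orbT.
have bk : b^-1 <= expR k%:R.
  rewrite -[leRHS]invrK -expRN lef_pV2 ?posrE ?expR_gt0//.
  by rewrite le_max lexx orbT.
rewrite (le_trans (le_ln1Dx _))//.
  by apply: lt_le_trans (ltrN10 R) _; rewrite divr_ge0// ltW.
by rewrite mulrC ler_pM ?invr_ge0 ?(ltW b0).
Qed.

(** The factor [c] stands for cutoffs, which are eventually 1 at a given point. For x > 0 the
    sequence is eventually constant; at x = 0 it is eventually k, and the limit is +oo. *)
Lemma cvg_tlog x (c : nat -> R) : 0 <= x -> (\forall k \near \oo, c k = 1) ->
  (tlog k x * c k)%:E @[k --> \oo] --> (- lne x%:E)%E.
Proof.
move=> x0 c1; have [->|xN0] := eqVneq x 0.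
  rewrite le0_lneNy//=; apply: (@cvg_trans _ ((k%:R : R)%:E @[k --> \oo])).
    apply: near_eq_cvg; near=> k.
    have -> : c k = 1 by near: k.
    by rewrite /tlog mulr1 max_r ?expR_ge0// expRK opprK.
  by apply/cvgenyP; exact: cvg_id.
have {xN0}x0 : 0 < x by rewrite lt_neqAle eq_sym xN0.
rewrite lne_EFin//; apply: cvg_near_cst; near=> k.
have -> : c k = 1 by near: k.
rewrite mulr1 /tlog max_l// -ler_ln ?posrE ?expR_gt0// expRK lerNl.
near: k; exact: nbhs_infty_ger.
Unshelve. all: by end_near. Qed.

End TruncatedLog.

Section Cutoff.
Variable R : realType.
Implicit Types (z w : R[i]) (k : nat).

Definition cutoff k z : R := Num.max 0 (Num.min 1 (k.+1%:R - modulus z)).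

Lemma cutoff_ge0 k z : 0 <= cutoff k z.
Proof. by rewrite le_max lexx. Qed.

Lemma cutoff_le1 k z : cutoff k z <= 1.
Proof. by rewrite ge_max ler01 ge_min lexx. Qed.

Lemma cutoff1 k z : modulus z <= k%:R -> cutoff k z = 1.
Proof.
move=> zk; rewrite /cutoff min_l ?max_r//.
by rewrite lerBrDr -natr1 addrC lerD2r.
Qed.

Lemma cutoff0 k z : k.+1%:R <= modulus z -> cutoff k z = 0.
Proof. by move=> zk; rewrite /cutoff max_l// ge_min subr_le0 zk orbT. Qed.

Lemma cutoff_homo z : {homo cutoff^~ z : m n / (m <= n)%N >-> m <= n}.
Proof.
move=> m n mn; rewrite /cutoff ge_max !le_max lexx/=.
rewrite [X in _ || X](_ : _ = true) ?orbT// le_min !ge_min lexx/=.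
by rewrite lerD2r ler_nat ltnS mn orbT.
Qed.

Lemma cutoff_lip k z w : `|cutoff k z - cutoff k w| <= modulus (z - w).
Proof.
apply: (@le_trans _ _ `|modulus z - modulus w|); last exact: modulus_dist.
rewrite (le_trans (ler_dist_maxl _ _ _))// (le_trans (ler_dist_minl _ _ _))//.
by rewrite opprB addrC addrA subrK distrC.
Qed.

Lemma continuous_cutoff k : continuous (cutoff k).
Proof.
by apply: (@lipschitz_continuousC _ _ 1) => z w; rewrite mul1r cutoff_lip.
Qed.

Lemma cutoff_near1 z : \forall k \near \oo, cutoff k z = 1.
Proof. by near=> k; apply: cutoff1; near: k; exact: nbhs_infty_ger.
Unshelve. all: by end_near. Qed.

Definition ell z : R := ln (1 + modulus z).

Lemma ell_ge0 z : 0 <= ell z.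
Proof. by rewrite ln_ge0// lerDl modulus_ge0. Qed.

Lemma continuous_ell : continuous ell.
Proof.
move=> z; apply: (@continuous_comp _ _ _ (fun z => 1 + modulus z) (@ln R)).
  apply: (@lipschitz_continuousC _ _ 1) => w w'.
  by rewrite opprD addrACA subrr add0r mul1r modulus_dist.
by apply: continuous_ln; rewrite ltr_pwDl ?modulus_ge0.
Qed.

End Cutoff.

(** * Weak convergence and integrals *)

Section MonotoneLimits.
Context d (T : measurableType d) (R : realType) (mu : {measure set T -> \bar R}).
Variables (f : nat -> T -> \bar R) (g : T -> \bar R).
Hypothesis mf : forall n, measurable_fun setT (f n).
Hypothesis f0 : forall n x, (0 <= f n x)%E.
Hypothesis f_homo : forall x, {homo f^~ x : m n / (m <= n)%N >-> (m <= n)%E}.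
Hypothesis fg : forall x, f n x @[n --> \oo] --> g x.

Lemma cvg_integral_homo : (\int[mu]_x f n x)%E @[n --> \oo] --> (\int[mu]_x g x)%E.
Proof.
have -> : (\int[mu]_x g x = \int[mu]_x limn (f^~ x))%E.
  by apply: eq_integral => x _; apply/esym/cvg_lim => //; exact: fg.
exact: cvg_monotone_convergence.
Qed.

Lemma integral_homo_le (c : \bar R) :
  (forall n, \int[mu]_x f n x <= c)%E -> (\int[mu]_x g x <= c)%E.
Proof.
move=> fc; have := cvg_integral_homo => h; rewrite -(cvg_lim _ h)//.
by apply: lime_le; [apply/cvg_ex; exists (\int[mu]_x g x)%E|exact: nearW].
Qed.

Lemma measurable_homo : measurable_fun setT g.
Proof.
have := @emeasurable_fun_cvg _ T R setT f g mf.
by apply => x _; exact: fg.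
Qed.

End MonotoneLimits.

Section TestFunctions.
Variable R : realType.
Implicit Types (mu : probability (borelC R) R) (X : nat -> seq R[i]).
Implicit Types f : R[i] -> R.

(** Lists of points stand for their normalized counting measures. Tests are nonnegative, so that
    their integrals are always meaningful, and compact support is expressed by a radius. *)
Definition weakly_cvg X mu := forall f, continuous f -> (forall z, 0 <= f z) ->
  (exists k : nat, forall z, k%:R <= modulus z -> f z = 0) ->
  (avg (X n) f)%:E @[n --> \oo] --> (\int[mu]_z (f z)%:E)%E.

Lemma continuousMC f g : continuous f -> continuous g ->
  continuous (fun z => f z * g z).
Proof. by move=> cf cg z; exact: cvgM (cf z) (cg z). Qed.

Lemma measurable_EFinC f : continuous f ->
  measurable_fun [set: borelC R] (fun z : borelC R => (f z)%:E).
Proof. by move=> cf; apply/measurable_EFinP; exact: continuous_measurableC. Qed.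

Lemma integral_cst_prob mu (c : R) : (\int[mu]_z c%:E)%E = c%:E.
Proof.
have -> : (\int[mu]_z c%:E = \int[mu]_z cst c%:E z)%E by [].
by rewrite integral_cst// -[RHS]mule1 -(probability_setT mu).
Qed.

Lemma integral_le_cst mu f (M : R) : continuous f -> (forall z, 0 <= f z) ->
  (forall z, f z <= M) -> (\int[mu]_z (f z)%:E <= M%:E)%E.
Proof.
move=> cf f0 fM; rewrite -[leRHS](integral_cst_prob mu).
apply: ge0_le_integral => //.
- by move=> x _; rewrite lee_fin.
- exact: measurable_EFinC.
- by move=> x _; rewrite lee_fin.
Qed.

Lemma integral_fin_num mu f (M : R) : continuous f -> (forall z, 0 <= f z) ->
  (forall z, f z <= M) -> (\int[mu]_z (f z)%:E)%E \is a fin_num.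
Proof.
move=> cf f0 fM; rewrite ge0_fin_numE; last first.
  by apply: integral_ge0 => z _; rewrite lee_fin.
by rewrite (le_lt_trans (integral_le_cst mu cf f0 fM))// ltry.
Qed.

Lemma weakly_cvg_le X mu f (a : nat -> R) (c M : R) : weakly_cvg X mu ->
  continuous f -> (forall z, 0 <= f z) -> (forall z, f z <= M) ->
  (exists k : nat, forall z, k%:R <= modulus z -> f z = 0) ->
  liminf_le a c -> (\forall n \near \oo, avg (X n) f <= a n) ->
  (\int[mu]_z (f z)%:E <= c%:E)%E.
Proof.
move=> Xmu cf f0 fM fk ac fa.
have fin := integral_fin_num mu cf f0 fM.
have := Xmu f cf f0 fk; rewrite -(fineK fin) => /fine_cvgP[_ h].
by rewrite lee_fin; exact: liminf_le_cvg ac h fa.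
Qed.

Lemma continuous_tlog k (u : R[i] -> R) : continuous u -> continuous (tlog k \o u).
Proof.
move=> cu z; apply: continuous_comp; first exact: cu.
move: (u z) => x; apply/cvgrPdist_lt => e e0; near=> y.
rewrite (le_lt_trans (tlog_lip _ _ _))// mulrC -ltr_pdivlMr ?expR_gt0//.
near: y; apply: cvgr_dist_lt => //; first by rewrite divr_gt0 ?expR_gt0.
Unshelve. all: by end_near. Qed.

(** For fixed k the truncated and cut off function lies below - ln u on [X n], so its integral is at
    most c; monotone convergence in k restores - log u. Positivity on [X n] keeps the default value
    of [ln] at 0 out of the averages. *)
Lemma integral_neglog_le X mu (u : R[i] -> R) (c : R) : weakly_cvg X mu ->
  continuous u -> (forall z, 0 <= u z) -> (forall z, u z <= 1) ->
  (\forall n \near \oo, {in X n, forall x, 0 < u x}) ->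
  liminf_le (fun n => avg (X n) (fun x => - ln (u x))) c ->
  (\int[mu]_z (- lne (u z)%:E) <= c%:E)%E.
Proof.
move=> Xmu cu u0 u1 Xu uc.
have cf k : continuous (fun z => tlog k (u z) * cutoff k z).
  by apply: continuousMC; [exact: continuous_tlog|exact: continuous_cutoff].
have f0 k z : 0 <= tlog k (u z) * cutoff k z.
  by rewrite mulr_ge0 ?tlog_ge0 ?cutoff_ge0.
apply: (@integral_homo_le _ (borelC R) R mu
  (fun k z => (tlog k (u z) * cutoff k z)%:E) (fun z => (- lne (u z)%:E)%E)).
- by move=> k; exact: measurable_EFinC.
- by move=> k z; rewrite lee_fin.
- move=> z m n mn; rewrite lee_fin ler_pM ?tlog_ge0 ?cutoff_ge0//.
    exact: tlog_homo.
  exact: cutoff_homo.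
- by move=> z; apply: cvg_tlog => //; exact: cutoff_near1.
move=> k; apply: (weakly_cvg_le (M := k%:R) Xmu) uc _ => //.
- move=> z; rewrite -[leRHS]mulr1 ler_pM ?tlog_ge0 ?cutoff_ge0 ?tlog_le//.
  exact: cutoff_le1.
- by exists k.+1 => z kz; rewrite cutoff0// mulr0.
apply: filterS Xu => n Xu; apply: ler_avg => x /Xu ux.
apply: le_trans (tlog_le_ln k ux).
by rewrite ler_piMr ?tlog_ge0// cutoff_le1.
Qed.

Section DoubleAverage.
Variables (X : nat -> seq R[i]) (mu : probability (borelC R) R).
Hypothesis Xmu : weakly_cvg X mu.
Variables (F : R[i] -> R[i] -> R) (M K : R) (k : nat).
Hypothesis F0 : forall z w, 0 <= F z w.
Hypothesis FM : forall z w, F z w <= M.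
Hypothesis F_lip : forall z z' w, `|F z w - F z' w| <= K * modulus (z - z').
Hypothesis F_cont : forall z, continuous (F z).
Hypothesis F_suppl : forall z w, k%:R <= modulus z -> F z w = 0.
Hypothesis F_suppr : forall z w, k%:R <= modulus w -> F z w = 0.

Let G z := fine (\int[mu]_w (F z w)%:E)%E.

Let K0 : 0 <= K.
Proof.
have := le_trans (normr_ge0 _) (F_lip 1 0 0).
by rewrite subr0 ComplexField.Normc.normc1 mulr1.
Qed.

Let GE z : (\int[mu]_w (F z w)%:E)%E = (G z)%:E.
Proof. by rewrite fineK//; exact: (integral_fin_num _ (M := M)). Qed.

Let G_ge0 z : 0 <= G z.
Proof. by apply: fine_ge0; apply: integral_ge0 => w _; rewrite lee_fin. Qed.

Let G_leM z : G z <= M.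
Proof. by rewrite -lee_fin -GE; exact: integral_le_cst. Qed.

Let G_lip z z' : `|G z - G z'| <= K * modulus (z - z').
Proof.
have H z1 z2 : G z1 <= G z2 + K * modulus (z1 - z2).
  rewrite -lee_fin EFinD -!GE.
  rewrite -[X in (_ <= _ + X)%E](integral_cst_prob mu) -ge0_integralD//; first last.
  - by move=> w _; rewrite lee_fin mulr_ge0 ?modulus_ge0.
  - exact: measurable_EFinC.
  - by move=> w _; rewrite lee_fin.
  apply: ge0_le_integral => //.
  - by move=> w _; rewrite lee_fin.
  - exact: measurable_EFinC.
  - by apply: emeasurable_funD => //; exact: measurable_EFinC.
  - move=> w _; rewrite -EFinD lee_fin -lerBlDl (le_trans (ler_norm _))//.
have := H z z'; have := H z' z; rewrite (modulusBC z') ler_norml => h1 h2.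
by apply/andP; split; lra.
Qed.

Lemma continuous_integral_kernel : continuous G.
Proof. exact: lipschitz_continuousC G_lip. Qed.

(* The inner averages converge pointwise and are uniformly Lipschitz, hence
   they converge uniformly on the compact support of [F]. *)
Lemma cvg_double_avg :
  (avg (X n) (fun z => avg (X n) (F z)))%:E @[n --> \oo] -->
  (\int[mu]_z \int[mu]_w (F z w)%:E)%E.
Proof.
under eq_integral do rewrite GE.
have Gsupp z : k%:R <= modulus z -> G z = 0.
  by move=> kz; rewrite /G; under eq_integral do rewrite F_suppl//; rewrite integral0.
pose Gn n z := avg (X n) (F z).
have Gn_lip n z z' : `|Gn n z - Gn n z'| <= K * modulus (z - z').
  by apply: avg_dist_le; [rewrite mulr_ge0 ?modulus_ge0|move=> x _; exact: F_lip].
have GnG z : Gn n z @[n --> \oo] --> G z.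
  by have /= := @Xmu (F z) (@F_cont z) (F0 z) (ex_intro _ k (@F_suppr z));
    rewrite GE => /fine_cvgP[].
have unif (e : R) : 0 < e -> \forall n \near \oo, forall z, `|Gn n z - G z| <= e.
  move=> e0.
  have e3 : 0 < e / 3 by rewrite divr_gt0.
  have [K1 K10 KK1] : exists2 K1, 0 < K1 & K <= K1.
    by exists (K + 1); rewrite ?ltr_wpDl// lerDl.
  have : \forall n \near \oo, [set z | modulus z <= k%:R] `<=` [set z | `|Gn n z - G z| <= e].
    (* Pointwise convergence at z costs e / 3, and the Lipschitz bounds move each of [Gn n] and [G]
       to a nearby point for another e / 3. *)
    apply: (compact_near_coveringP _).1; first exact: compact_disk.
    move=> z _.
    have nz : \forall z' \near z, modulus (z - z') < e / 3 / K1.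
      by apply/nbhs_modulus; exists (e / 3 / K1) => //; rewrite divr_gt0.
    have nn : \forall n \near \oo, `|Gn n z - G z| < e / 3.
      by apply: cvgr_distC_lt e3; exact: GnG.
    exists ([set z' | modulus (z - z') < e / 3 / K1], [set n | `|Gn n z - G z| < e / 3]) => //.
    move=> [z' n] [/= zz' nz'].
    have Kz : K * modulus (z - z') <= e / 3.
      rewrite (le_trans (ler_wpM2r (modulus_ge0 _) KK1))//.
      by rewrite mulrC -ler_pdivlMr// ltW.
    have h1 := le_trans (Gn_lip n z z') Kz.
    have h2 := le_trans (G_lip z z') Kz.
    move: h1 h2 (ltW nz'); rewrite !ler_norml.
    by move=> /andP[? ?] /andP[? ?] /andP[? ?]; apply/andP; split; lra.
  apply: filterS => n Hn z; have [zk|/ltW kz] := leP (modulus z) k%:R.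
    exact: Hn.
  rewrite Gsupp// /Gn (_ : F z = fun=> 0); last by apply/funext => w; exact: F_suppl.
  by rewrite /avg big1// mulr0 subr0 normr0 ltW.
have hG := Xmu continuous_integral_kernel G_ge0 (ex_intro _ k Gsupp).
have fin := integral_fin_num mu continuous_integral_kernel G_ge0 G_leM.
move: hG; rewrite -(fineK fin) => /fine_cvgP[_ hG].
have hG' : avg (X n) G @[n --> \oo] --> fine (\int[mu]_z (G z)%:E)%E := hG.
apply: cvg_EFin; first by apply: nearW.
apply/cvgrPdist_le => e e0; have e2 : 0 < e / 2 by rewrite divr_gt0.
move/cvgrPdist_le: hG' => /(_ _ e2) hG'.
near=> n.
have h1 : `|avg (X n) (Gn n) - avg (X n) G| <= e / 2.
  have hn : forall z, `|Gn n z - G z| <= e / 2 by near: n; exact: unif.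
  by apply: avg_dist_le; [exact: ltW|move=> x _; exact: hn].
have h2 : `|fine (\int[mu]_z (G z)%:E)%E - avg (X n) G| <= e / 2.
  by near: n.
rewrite /=; move: h1 h2; rewrite !ler_norml.
by move=> /andP[? ?] /andP[? ?]; apply/andP; split; lra.
Unshelve. all: by end_near. Qed.

End DoubleAverage.

End TestFunctions.

(** * The chordal kernel *)

Lemma adde_eq_sube (R : realType) (A B U V : \bar R) :
  B \is a fin_num -> V \is a fin_num ->
  (A + V = B + U)%E -> (A - B = U - V)%E.
Proof.
move=> /fineK <- /fineK <-; move: (fine B) (fine V) => b v.
by case: A => [a| |]; case: U => [u| |] //= [h]; congr EFin; lra.
Qed.

Section IntegralDifference.
Context d (T : measurableType d) (R : realType) (mu : {measure set T -> \bar R}).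
Variables (U : T -> \bar R) (v : T -> R).
Hypothesis mU : measurable_fun setT U.
Hypothesis U0 : forall x, (0 <= U x)%E.
Hypothesis mv : measurable_fun setT v.
Hypothesis v0 : forall x, 0 <= v x.
Hypothesis v_fin : (\int[mu]_x (v x)%:E < +oo)%E.

Let f x := (U x - (v x)%:E)%E.

Let mf : measurable_fun setT f.
Proof. by apply: emeasurable_funB => //; exact/measurable_EFinP. Qed.

Let fneg_fin : (\int[mu]_x f^\- x)%E \is a fin_num.
Proof.
rewrite ge0_fin_numE; last exact: integral_ge0.
apply: le_lt_trans v_fin; apply: ge0_le_integral => //.
- exact: measurable_funeneg.
- exact/measurable_EFinP.
move=> x _; rewrite funenegE /f ge_max lee_fin v0 andbT.
case: (U x) (U0 x) => [u| |] //; last by rewrite leNye.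
by rewrite lee_fin => u0; rewrite -EFinB -EFinN lee_fin; lra.
Qed.

(** [U] may take the value +oo or have infinite integral. The identity f^+ + v = f^- + U between
    nonnegative functions is integrated instead, and only the finite integrals of v and f^- (at most
    v) cross the equality. *)
Lemma integral_subr_EFin :
  (\int[mu]_x (U x - (v x)%:E) = \int[mu]_x U x - \int[mu]_x (v x)%:E)%E.
Proof.
have vf : (\int[mu]_x (v x)%:E)%E \is a fin_num.
  by rewrite ge0_fin_numE// integral_ge0// => x _; rewrite lee_fin.
rewrite -/(f _) integralE -/f.
have : (\int[mu]_x f^\+ x + \int[mu]_x (v x)%:E
        = \int[mu]_x f^\- x + \int[mu]_x U x)%E.
  have mfp := measurable_funepos mf; have mfn := measurable_funeneg mf.
  have mv' : measurable_fun setT (fun x => (v x)%:E) by exact/measurable_EFinP.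
  have v0' x : (0 <= (v x)%:E)%E by rewrite lee_fin.
  rewrite -!ge0_integralD//.
  apply: eq_integral => x _; rewrite funeposE funenegE /f.
  case: (U x) (U0 x) => [u| |]//= u0; last by rewrite maxye maxNye.
  rewrite -EFinD -!EFin_max -!EFinD; congr EFin.
  by case: (leP (u - v x) 0); case: (leP (- (u - v x)) 0); lra.
by apply: adde_eq_sube vf; exact: fneg_fin.
Qed.

Lemma integral_EFin_subr :
  (\int[mu]_x ((v x)%:E - U x) = \int[mu]_x (v x)%:E - \int[mu]_x U x)%E.
Proof.
transitivity (\int[mu]_x - f x)%E.
  by apply: eq_integral => x _; rewrite /f fin_num_oppeB// addeC.
rewrite integralN; last first.
  by apply: fin_num_adde_defl; rewrite fin_numN; exact: fneg_fin.
have vf : (\int[mu]_x (v x)%:E)%E \is a fin_num.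
  by rewrite ge0_fin_numE// integral_ge0// => x _; rewrite lee_fin.
by rewrite integral_subr_EFin fin_num_oppeB// addeC.
Qed.

End IntegralDifference.

Section ChordalKernel.
Variable R : realType.
Implicit Types (z w : R[i]) (mu : probability (borelC R) R).

(** Up to bounded factors this is the chordal distance on the Riemann sphere, with 1 + |z| in place
    of sqrt (1 + |z|^2). *)
Definition chordal z w : R :=
  modulus (z - w) / ((1 + modulus z) * (1 + modulus w)).

Lemma onep_modulus_gt0 z : 0 < 1 + modulus z.
Proof. by rewrite ltr_pwDl ?modulus_ge0. Qed.

Lemma chordal_ge0 z w : 0 <= chordal z w.
Proof. by rewrite divr_ge0 ?modulus_ge0// ltW// mulr_gt0 ?onep_modulus_gt0. Qed.

Lemma chordalC z w : chordal z w = chordal w z.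
Proof. by rewrite /chordal modulusBC [_ * (1 + modulus w)]mulrC. Qed.

Lemma modulusB_le z w : modulus (z - w) <= modulus z + modulus w.
Proof. by rewrite -(normcN w) le_normcD. Qed.

Lemma chordal_le1 z w : chordal z w <= 1.
Proof.
rewrite ler_pdivrMr ?mulr_gt0 ?onep_modulus_gt0// mul1r.
rewrite (le_trans (modulusB_le _ _))// mulrDl mul1r mulrDr mulr1.
have := mulr_ge0 (modulus_ge0 z) (modulus_ge0 w).
by lra.
Qed.

Lemma modulusB_gt0 z w : z != w -> 0 < modulus (z - w).
Proof.
move=> zw; rewrite lt_neqAle modulus_ge0 andbT eq_sym.
apply: contra zw => /eqP/ComplexField.Normc.eq0_normc/eqP.
by rewrite subr_eq0.
Qed.

Lemma chordal_gt0 z w : z != w -> 0 < chordal z w.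
Proof.
move=> zw; rewrite divr_gt0// ?mulr_gt0 ?onep_modulus_gt0//.
exact: modulusB_gt0.
Qed.

Lemma ln_chordal z w : z != w ->
  - ln (chordal z w) = ell z + ell w - ln (modulus (z - w)).
Proof.
move=> zw; have zw0 := modulusB_gt0 zw.
rewrite /chordal ln_div ?posrE ?mulr_gt0 ?onep_modulus_gt0//.
by rewrite lnM ?posrE ?onep_modulus_gt0// opprB.
Qed.

(** On the diagonal both sides are +oo, so the identity holds without an exceptional set. *)
Lemma lne_chordal z w :
  (- logmod (z - w)%R = - lne (chordal z w)%:E - (ell z + ell w)%:E)%E.
Proof.
have [->|zw] := eqVneq z w.
  by rewrite /logmod /chordal subrr ComplexField.Normc.normc0 mul0r /= lexx.
rewrite lne_EFin ?chordal_gt0// -EFinN ln_chordal// /logmod lne_EFin ?modulusB_gt0//.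
by rewrite -EFinN -EFinB addrAC subrr add0r.
Qed.

(** Over the common denominator (1 + |z|) (1 + |z'|) (1 + |w|) the numerator is at most |z - z'| (1
    + 2 |z'| + |w|), and the last factor is at most twice the denominator; hence a constant
    independent of w. *)
Lemma chordal_lip z z' w : `|chordal z w - chordal z' w| <= 2 * modulus (z - z').
Proof.
have a0 := onep_modulus_gt0 z; have a0' := onep_modulus_gt0 z'.
have b0 := onep_modulus_gt0 w.
have -> : chordal z w - chordal z' w =
    ((modulus (z - w) - modulus (z' - w)) * (1 + modulus z')
     + modulus (z' - w) * (modulus z' - modulus z))
    / ((1 + modulus z) * (1 + modulus z') * (1 + modulus w)).
  by rewrite /chordal; field; rewrite !gt_eqF.
rewrite normrM [X in _ * X <= _]gtr0_norm ?invr_gt0 ?mulr_gt0//.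
rewrite ler_pdivrMr ?mulr_gt0// (le_trans (ler_normD _ _))// !normrM.
rewrite (gtr0_norm a0') (ger0_norm (modulus_ge0 (z' - w))).
have h1 : `|modulus (z - w) - modulus (z' - w)| <= modulus (z - z').
  by rewrite (le_trans (modulus_dist _ _))// opprB addrA subrK.
have h2 : `|modulus z' - modulus z| <= modulus (z - z').
  by rewrite modulusBC modulus_dist.
have h3 := modulusB_le z' w.
apply: (le_trans (lerD (ler_wpM2r (ltW a0') h1) (ler_pM _ _ h3 h2))).
- exact: modulus_ge0.
- exact: normr_ge0.
have := modulus_ge0 (z - z'); move: (modulus_ge0 z) (modulus_ge0 z') (modulus_ge0 w).
move: (modulus z) (modulus z') (modulus w) (modulus (z - z')) => a b c e a_ge0 b_ge0 c_ge0 e_ge0.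
have D : 0 <= 2 * ((1 + a) * (1 + b) * (1 + c)) - (1 + b) - (b + c).
  have := mulr_ge0 a_ge0 b_ge0; have := mulr_ge0 a_ge0 c_ge0.
  have bc := mulr_ge0 b_ge0 c_ge0; have := mulr_ge0 a_ge0 bc.
  lra.
by have := mulr_ge0 e_ge0 D; lra.
Qed.

Definition chordal_test (k : nat) z w : R :=
  tlog k (chordal z w) * (cutoff k z * cutoff k w).

Lemma chordal_test_ge0 k z w : 0 <= chordal_test k z w.
Proof. by rewrite mulr_ge0 ?tlog_ge0 ?chordal_le1// mulr_ge0 ?cutoff_ge0. Qed.

Lemma chordal_test_le_tlog k z w : chordal_test k z w <= tlog k (chordal z w).
Proof.
by rewrite ler_piMr ?tlog_ge0 ?chordal_le1// mulr_ile1 ?cutoff_ge0 ?cutoff_le1.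
Qed.

Lemma chordal_test_le k z w : chordal_test k z w <= k%:R.
Proof. exact: le_trans (chordal_test_le_tlog _ _ _) (tlog_le _ _). Qed.

Lemma chordal_test_homo z w :
  {homo (fun k => chordal_test k z w) : m n / (m <= n)%N >-> m <= n}.
Proof.
move=> m n mn; rewrite /chordal_test ler_pM ?tlog_ge0 ?chordal_le1 ?mulr_ge0 ?cutoff_ge0//.
  exact: tlog_homo.
by rewrite ler_pM ?cutoff_ge0//; exact: cutoff_homo.
Qed.

Lemma cvg_chordal_test z w :
  (chordal_test k z w)%:E @[k --> \oo] --> (- lne (chordal z w)%:E)%E.
Proof.
apply: cvg_tlog; first exact: chordal_ge0.
near=> k; have -> : cutoff k z = 1 by near: k; exact: cutoff_near1.
by rewrite mul1r; near: k; exact: cutoff_near1.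
Unshelve. all: by end_near. Qed.

(** The product rule: e^k from [tlog] times 2 from [chordal], plus the bound k on [tlog] times the
    Lipschitz constant 1 of the cutoff. *)
Lemma chordal_test_lip k z z' w :
  `|chordal_test k z w - chordal_test k z' w|
    <= (expR k%:R * 2 + k%:R) * modulus (z - z').
Proof.
rewrite /chordal_test !mulrA -mulrBl normrM (ger0_norm (cutoff_ge0 k w)).
apply: (@le_trans _ _ `|tlog k (chordal z w) * cutoff k z - tlog k (chordal z' w) * cutoff k z'|).
  by rewrite ler_piMr// cutoff_le1.
set a := tlog k (chordal z w); set a' := tlog k (chordal z' w).
have -> : a * cutoff k z - a' * cutoff k z'
    = (a - a') * cutoff k z + a' * (cutoff k z - cutoff k z') by ring.
rewrite (le_trans (ler_normD _ _))// [leRHS]mulrDl lerD// normrM.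
  rewrite (ger0_norm (cutoff_ge0 k z)) (@le_trans _ _ `|a - a'|)//.
    by rewrite ler_piMr// cutoff_le1.
  rewrite (le_trans (tlog_lip _ _ _))// -mulrA ler_wpM2l ?expR_ge0//.
  exact: chordal_lip.
rewrite ler_pM// ?cutoff_lip//.
by rewrite ger0_norm ?tlog_le// tlog_ge0// chordal_le1.
Qed.

Lemma continuous_chordal_test k z : continuous (chordal_test k z).
Proof.
apply: (@lipschitz_continuousC _ _ (expR k%:R * 2 + k%:R)) => w w'.
have E x : chordal_test k z x = chordal_test k x z.
  by rewrite /chordal_test chordalC [cutoff k z * _]mulrC.
by rewrite !E chordal_test_lip.
Qed.

Lemma chordal_test_suppl k z w : k.+1%:R <= modulus z -> chordal_test k z w = 0.
Proof. by move=> kz; rewrite /chordal_test cutoff0// mul0r mulr0. Qed.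

Lemma chordal_test_suppr k z w : k.+1%:R <= modulus w -> chordal_test k z w = 0.
Proof. by move=> kz; rewrite /chordal_test [cutoff k w]cutoff0// !mulr0. Qed.

Lemma measurable_lne_chordal z :
  measurable_fun [set: borelC R] (fun w : borelC R => (- lne (chordal z w)%:E)%E).
Proof.
apply: (@measurable_homo _ (borelC R) R (fun k w => (chordal_test k z w)%:E)).
- by move=> k; apply: measurable_EFinC; exact: continuous_chordal_test.
- by move=> w; exact: cvg_chordal_test.
Qed.

Lemma lne_chordal_ge0 z w : (0 <= - lne (chordal z w)%:E)%E.
Proof. by rewrite oppe_ge0 lne_le0 lee_fin chordal_le1. Qed.

Definition chordal_potential mu z : \bar R := (\int[mu]_w - lne (chordal z w)%:E)%E.

Definition test_potential mu k z : \bar R := (\int[mu]_w (chordal_test k z w)%:E)%E.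

Lemma cvg_test_potential mu z :
  test_potential mu k z @[k --> \oo] --> chordal_potential mu z.
Proof.
apply: (@cvg_integral_homo _ (borelC R) R mu (fun k w => (chordal_test k z w)%:E)).
- by move=> k; apply: measurable_EFinC; exact: continuous_chordal_test.
- by move=> k w; rewrite lee_fin chordal_test_ge0.
- by move=> w m n mn; rewrite lee_fin; exact: chordal_test_homo.
- by move=> w; exact: cvg_chordal_test.
Qed.

Lemma measurable_test_potential mu k :
  measurable_fun [set: borelC R] (test_potential mu k : borelC R -> \bar R).
Proof.
have fin z : test_potential mu k z \is a fin_num.
  apply: (integral_fin_num _ (M := k%:R)).
  - exact: continuous_chordal_test.
  - by move=> w; exact: chordal_test_ge0.
  - by move=> w; exact: chordal_test_le.
rewrite (_ : test_potential mu k = (fun z => (fine (test_potential mu k z))%:E)).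
  apply: (@measurable_EFinC R (fun z : R[i] => fine (test_potential mu k z))).
  exact: (@continuous_integral_kernel R mu (chordal_test k) k%:R (expR k%:R * 2 + k%:R)
    (chordal_test_ge0 k) (chordal_test_le k) (chordal_test_lip k)
    (@continuous_chordal_test k)).
by apply/funext => z; rewrite fineK.
Qed.

Lemma measurable_chordal_potential mu :
  measurable_fun [set: borelC R] (chordal_potential mu : borelC R -> \bar R).
Proof.
apply: (@measurable_homo _ (borelC R) R (test_potential mu)).
- by move=> k; exact: measurable_test_potential.
- by move=> w; exact: cvg_test_potential.
Qed.

Lemma chordal_potential_ge0 mu z : (0 <= chordal_potential mu z)%E.
Proof. by apply: integral_ge0 => w _; exact: lne_chordal_ge0. Qed.

(** The discrete energy omits the diagonal. For fixed k, putting it back in the double average of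
    the truncated kernel adds at most k divided by the number of points, which tends to 0; the limit
    in k is taken only afterwards. *)
Lemma chordal_energy_le (X : nat -> seq R[i]) mu (c : R) :
  weakly_cvg X mu -> (forall n, uniq (X n)) ->
  (size (X n))%:R^-1 @[n --> \oo] --> (0 : R) ->
  liminf_le (fun n => avg (X n) (fun z => avg (X n)
    (fun w => if w == z then 0 else - ln (chordal z w)))) c ->
  (\int[mu]_z chordal_potential mu z <= c%:E)%E.
Proof.
move=> Xmu Xuniq Xsize Xc.
apply: (@integral_homo_le _ (borelC R) R mu (test_potential mu)).
- by move=> k; exact: measurable_test_potential.
- by move=> k z; apply: integral_ge0 => w _; rewrite lee_fin chordal_test_ge0.
- move=> z m n mn; apply: ge0_le_integral => //.
  + by move=> w _; rewrite lee_fin chordal_test_ge0.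
  + by apply: measurable_EFinC; exact: continuous_chordal_test.
  + by apply: measurable_EFinC; exact: continuous_chordal_test.
  + by move=> w _; rewrite lee_fin; exact: chordal_test_homo.
- by move=> z; exact: cvg_test_potential.
move=> k.
have le_k z : (test_potential mu k z <= k%:R%:E)%E.
  apply: integral_le_cst.
  - exact: continuous_chordal_test.
  - by move=> w; exact: chordal_test_ge0.
  - by move=> w; exact: chordal_test_le.
have ge_0 z : (0 <= test_potential mu k z)%E.
  by apply: integral_ge0 => w _; rewrite lee_fin chordal_test_ge0.
have fin : (\int[mu]_z test_potential mu k z)%E \is a fin_num.
  rewrite ge0_fin_numE ?integral_ge0//.
  apply: (@le_lt_trans _ _ (\int[mu]_z k%:R%:E)%E); last first.
    by rewrite integral_cst_prob ltry.
  apply: ge0_le_integral => //; exact: measurable_test_potential.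
have := @cvg_double_avg R X mu Xmu (chordal_test k) k%:R (expR k%:R * 2 + k%:R) k.+1
  (chordal_test_ge0 k) (chordal_test_le k) (chordal_test_lip k)
  (@continuous_chordal_test k) (@chordal_test_suppl k) (@chordal_test_suppr k).
rewrite -/(test_potential _ _ _) -(fineK fin) => /fine_cvgP[_ h].
rewrite lee_fin.
have hs : k%:R * (size (X n))%:R^-1 @[n --> \oo] --> (0 : R).
  by rewrite -[X in _ --> X](mulr0 k%:R); apply: cvgM => //; exact: cvg_cst.
have h' : liminf_le (fun n => avg (X n) (fun z => avg (X n) (chordal_test k z))) c.
  rewrite -[c]addr0 -[X in X + 0]mul1r; apply: (liminf_le_affine ler01 Xc hs).
  apply: nearW => n; rewrite mul1r.
  apply: (@le_trans _ _ (avg (X n) (fun z => avg (X n)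
    (fun w => if w == z then 0 else - ln (chordal z w)) + k%:R / (size (X n))%:R))).
    apply: ler_avg => z zX; rewrite -lerBlDl -avgB /avg mulrC ler_wpM2r ?invr_ge0//.
    rewrite (bigD1_seq z)//= eqxx subr0 -[leRHS]addr0 lerD ?chordal_test_le//.
    apply: sumr_le0 => w wz; rewrite (negPf wz) subr_le0.
    apply: le_trans (chordal_test_le_tlog _ _ _) (tlog_le_ln _ _).
    by rewrite chordal_gt0// eq_sym.
  by rewrite avgD lerD2l avg_cst_le// divr_ge0.
by apply: (liminf_le_cvg h' h); exact: nearW.
Qed.

End ChordalKernel.

(** * Potentials and Green functions *)

Section Potentials.
Variable R : realType.
Implicit Types (z w : R[i]) (mu nu : probability (borelC R) R).

Let measurable_ell : measurable_fun [set: borelC R] (@ell R : borelC R -> R).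
Proof. apply: continuous_measurableC; exact: continuous_ell. Qed.

Lemma integral_addr_ell mu z : (\int[mu]_w (ell w)%:E < +oo)%E ->
  (\int[mu]_w (ell z + ell w)%:E = (ell z)%:E + \int[mu]_w (ell w)%:E)%E.
Proof.
move=> fin; under eq_integral do rewrite EFinD.
rewrite ge0_integralD ?integral_cst_prob//.
- by move=> w _; rewrite lee_fin ell_ge0.
- by move=> w _; rewrite lee_fin ell_ge0.
- exact/measurable_EFinP.
Qed.

(** This is [lne_chordal] integrated twice. Finiteness of the integral of l legitimizes the
    subtraction, while the energy itself may still be +oo. *)
Lemma log_energyE mu : (\int[mu]_z (ell z)%:E < +oo)%E ->
  log_energy mu = (\int[mu]_z chordal_potential mu z - 2%:E * \int[mu]_z (ell z)%:E)%E.
Proof.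
move=> fin.
have ellfin : (\int[mu]_z (ell z)%:E)%E \is a fin_num.
  by rewrite ge0_fin_numE// integral_ge0// => z _; rewrite lee_fin ell_ge0.
pose L := fine (\int[mu]_z (ell z)%:E)%E.
have LE : (\int[mu]_z (ell z)%:E = L%:E)%E by rewrite fineK.
have L0 : 0 <= L by apply: fine_ge0; apply: integral_ge0 => z _; rewrite lee_fin ell_ge0.
have inner z : (\int[mu]_w - logmod (z - w)%R
    = chordal_potential mu z - (ell z + L)%:E)%E.
  under eq_integral do rewrite lne_chordal.
  rewrite (@integral_subr_EFin _ (borelC R) R mu (fun w => (- lne (chordal z w)%:E)%E)
    (fun w => ell z + ell w)).
  - by rewrite integral_addr_ell// LE -EFinD.
  - exact: measurable_lne_chordal.
  - by move=> w; exact: lne_chordal_ge0.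
  - exact: measurable_funD.
  - by move=> w; rewrite addr_ge0 ?ell_ge0.
  - by rewrite integral_addr_ell// LE -EFinD ltry.
have outer : (\int[mu]_z (ell z + L)%:E = (2 * L)%:E)%E.
  under eq_integral do rewrite EFinD.
  rewrite ge0_integralD ?integral_cst_prob//.
  - by rewrite LE -EFinD mulr_natl mulr2n.
  - by move=> w _; rewrite lee_fin ell_ge0.
  - exact/measurable_EFinP.
rewrite /log_energy; under eq_integral do rewrite inner.
rewrite (@integral_subr_EFin _ (borelC R) R mu (chordal_potential mu)
    (fun w => ell w + L)).
- by rewrite outer LE -EFinM.
- exact: measurable_chordal_potential.
- by move=> w; exact: chordal_potential_ge0.
- exact: measurable_funD.
- by move=> w; rewrite addr_ge0 ?ell_ge0.
- by rewrite outer ltry.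
Qed.

Lemma integral_ell_le nu (rho : R) : 0 <= rho ->
  {ae nu, forall w : borelC R, modulus (w : R[i]) <= rho} ->
  (\int[nu]_w (ell w)%:E <= (ln (1 + rho))%:E)%E.
Proof.
move=> rho0 nu_rho; rewrite -[leRHS](integral_cst_prob nu).
apply: ae_ge0_le_integral => //.
- by move=> w _; rewrite lee_fin ell_ge0.
- exact/measurable_EFinP.
- by move=> w _; rewrite lee_fin ln_ge0// lerDl.
apply: filterS nu_rho => w wrho _; rewrite lee_fin ler_ln ?posrE ?onep_modulus_gt0//.
  by rewrite lerD2l.
by rewrite ltr_pwDl.
Qed.

(** If |w| <= rho, the threshold on |z| gives |z - w| >= |z| - rho >= (1 + |z|) / 2, hence - log
    u(z, w) <= log (2 (1 + rho)). The integral of l(w) is nonnegative and is dropped. *)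
Lemma integral_logmod_ge nu (rho : R) z : 0 <= rho ->
  {ae nu, forall w : borelC R, modulus (w : R[i]) <= rho} ->
  2 * rho + 1 <= modulus z ->
  ((ell z - ln (2 * (1 + rho)))%:E <= \int[nu]_w logmod (z - w)%R)%E.
Proof.
move=> rho0 nu_rho zrho.
have fin : (\int[nu]_w (ell w)%:E < +oo)%E.
  by rewrite (le_lt_trans (integral_ell_le rho0 nu_rho))// ltry.
have E w : logmod (z - w)%R = ((ell z + ell w)%:E - (- lne (chordal z w)%:E))%E.
  rewrite -[LHS]oppeK lne_chordal fin_num_oppeB//.
  by rewrite addeC oppeK.
under eq_integral do rewrite E.
rewrite (@integral_EFin_subr _ (borelC R) R nu (fun w => (- lne (chordal z w)%:E)%E)
    (fun w => ell z + ell w)).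
- rewrite EFinB integral_addr_ell// leeB//.
    by rewrite leeDl// integral_ge0// => w _; rewrite lee_fin ell_ge0.
  rewrite -[leRHS](integral_cst_prob nu).
  apply: ae_ge0_le_integral => //.
  + by move=> w _; exact: lne_chordal_ge0.
  + exact: measurable_lne_chordal.
  + by move=> w _; rewrite lee_fin ln_ge0//; lra.
  apply: filterS nu_rho => w wrho _.
  have zw : (1 + modulus z) / 2 <= modulus (z - w).
    have := le_trans (ler_norm _) (modulus_dist z w); lra.
  have zw0 : 0 < modulus (z - w) by have := onep_modulus_gt0 z; lra.
  have hw := onep_modulus_gt0 w; have hz := onep_modulus_gt0 z.
  rewrite lne_EFin; last by rewrite divr_gt0 ?mulr_gt0.
  rewrite -EFinN lee_fin -lnV ?posrE ?divr_gt0 ?mulr_gt0//.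
  rewrite ler_ln ?posrE ?invr_gt0 ?divr_gt0 ?mulr_gt0//; last lra.
  rewrite invf_div ler_pdivrMr//.
  have h1 : 2 * modulus (z - w) >= 1 + modulus z by lra.
  rewrite mulrAC; apply: ler_pM => //; rewrite ?(ltW hz) ?(ltW hw)//.
  by rewrite lerD2l.
- exact: measurable_lne_chordal.
- by move=> w; exact: lne_chordal_ge0.
- exact: measurable_funD.
- by move=> w; rewrite addr_ge0 ?ell_ge0.
- by rewrite integral_addr_ell// lte_add_pinfty// ltry.
Qed.

Lemma supported_in_disk (K : set R[i]) nu (rho : R) : compact K ->
  (forall z, K z -> modulus z <= rho) -> supported_in K nu ->
  {ae nu, forall w : borelC R, modulus (w : R[i]) <= rho}.
Proof.
move=> cK Krho nuK; exists (~` K); split=> //.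
  apply: sub_sigma_algebra; rewrite openC.
  by apply: compact_closed => //; exact: norm_hausdorff.
by move=> w /=; apply: contra_not => /Krho.
Qed.

(** The log capacity enters the Green function with a minus sign, so a lower bound on it calls for
    an upper bound here: as - log u >= 0, every energy is at least -2 times the integral of l. *)
Lemma lne_capacity_le (K : set R[i]) (rho : R) : compact K -> 0 <= rho ->
  (forall z, K z -> modulus z <= rho) ->
  (lne (capacity K) <= (2 * ln (1 + rho))%:E)%E.
Proof.
move=> cK rho0 Krho; rewrite /capacity expeRK leeNl.
apply: le_ereal_inf_tmp => _ [nu nuK <-].
have h := integral_ell_le rho0 (supported_in_disk cK Krho nuK).
rewrite log_energyE; last by rewrite (le_lt_trans h)// ltry.
rewrite -EFinN -[leLHS]add0e EFinN leeB//.
  by apply: integral_ge0 => z _; exact: chordal_potential_ge0.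
by rewrite EFinM lee_wpmul2l// lee_fin.
Qed.

(* When there is no equilibrium measure, [get] returns the default point, which
   is a Dirac mass; hence no existence theorem is needed here. *)
Lemma equilibrium_measure_disk (K : set R[i]) : compact K ->
  exists2 rho : R, 0 <= rho &
    {ae equilibrium_measure K, forall w : borelC R, modulus (w : R[i]) <= rho}.
Proof.
move=> cK; have [rho Krho] := compact_bounded_modulus cK.
have [eqK|noeq] := pselect (exists nu, is_equilibrium K nu).
  exists `|rho| => //; apply: supported_in_disk (getPex eqK).1 => //.
  by move=> z /Krho zrho; rewrite (le_trans zrho) ?ler_norm.
rewrite /equilibrium_measure getPN; last by move=> nu nuK; apply: noeq; exists nu.
exists (modulus (point : borelC R)); first exact: modulus_ge0.
exists (~` [set w : borelC R | modulus (w : R[i]) <= modulus (point : borelC R)]).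
split=> //.
  by apply: sub_sigma_algebra; rewrite openC; exact: closed_disk.
by rewrite /point/= /dirac indicE memNset//=; apply; exact: lexx.
Qed.

(* This one-sided estimate holds for every compactly supported probability
   measure in place of the equilibrium measure. *)
Lemma green_ge (K : set R[i]) : compact K ->
  exists r C : R, [/\ 0 <= C & forall z, r <= modulus z -> ((ell z - C)%:E <= green K z)%E].
Proof.
move=> cK; have [rho rho0 nurho] := equilibrium_measure_disk cK.
have [sigma Ksigma] := compact_bounded_modulus cK.
exists (2 * rho + 1), (ln (2 * (1 + rho)) + 2 * ln (1 + `|sigma|)); split.
  rewrite addr_ge0// ?ln_ge0//; first lra.
  by rewrite mulr_ge0// ln_ge0// lerDl.
move=> z zrho; rewrite opprD addrA EFinB leeB//; first exact: integral_logmod_ge.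
apply: lne_capacity_le => // w /Ksigma; move/le_trans; apply; exact: ler_norm.
Qed.

End Potentials.

(** * Escape of mass *)

Section LiminfEreal.
Variable R : realType.
Implicit Types u v : nat -> \bar R.

Lemma le_limn_einf u v : (forall n, u n <= v n)%E -> (limn_einf u <= limn_einf v)%E.
Proof.
move=> uv; rewrite !limn_einf_lim; apply: lee_lim; [exact: is_cvg_einfs..|].
apply: nearW => n; apply: le_ereal_inf_tmp => _ [m nm <-].
by apply: le_trans (uv m); apply: ereal_inf_lbound; exists m.
Qed.

Lemma limn_einf_ge u (t : \bar R) (N : nat) :
  (forall n, (N <= n)%N -> (t <= u n)%E) -> (t <= limn_einf u)%E.
Proof.
move=> tu; rewrite limn_einf_lim; apply: lime_ge; first exact: is_cvg_einfs.
near=> n; apply: le_ereal_inf_tmp => _ [m /= nm <-]; apply: tu.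
by apply: leq_trans nm; near: n; exact: nbhs_infty_ge.
Unshelve. all: by end_near. Qed.

Lemma limn_einf_lt u (t : \bar R) : (limn_einf u < t)%E ->
  forall N, exists2 n, (N <= n)%N & (u n < t)%E.
Proof.
move=> ut N; apply: contrapT => noex; move: ut; apply/negP; rewrite -leNgt.
apply: (@limn_einf_ge _ _ N) => n Nn; rewrite leNgt; apply/negP => utn.
by apply: noex; exists n.
Qed.

(** Composition with [Num.max r0] makes the monotonicity global. The tail sums of the Green function
    decrease in r only from where that function is known to be nonnegative. *)
Lemma nonincreasing_near_cvge (f : R -> \bar R) (r0 : R) :
  (forall r s, r0 <= r -> r <= s -> (f s <= f r)%E) -> cvg (f @ +oo).
Proof.
move=> f_dec; apply/cvg_ex.
exists (ereal_inf (range (fun r => f (Num.max r0 r)))).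
have fE : \forall r \near +oo, f (Num.max r0 r) = f r.
  by near=> r; congr f; apply: max_r; near: r; apply: nbhs_pinfty_ge; exact: num_real.
apply: cvg_trans (near_eq_cvg fE) _; apply: nonincreasing_cvge.
move=> r s rs; apply: f_dec; first by rewrite le_max lexx.
by rewrite ge_max !le_max lexx rs orbT.
Unshelve. all: by end_near. Qed.

End LiminfEreal.

Section EllMass.
Variable R : realType.
Variables (X : nat -> seq R[i]) (mu : probability (borelC R) R).
Hypothesis Xmu : weakly_cvg X mu.
Variables E C : R.
Hypothesis C0 : 0 <= C.
(** What remains of the escape rate [E] once the Green function is replaced by its lower bound l -
    C: the radius can be taken as large as desired, and the bound then holds for infinitely many
    n. *)
Hypothesis tailE : forall t, E < t -> forall r1, exists2 r, r1 <= r &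
  forall N, exists2 n, (N <= n)%N &
    avg (X n) (fun x => if r <= modulus x then ell x - C else 0) <= t.

Let ell_cut (k : nat) (z : R[i]) : R := ell z * cutoff k z.

Let ell_cut_cont k : continuous (ell_cut k).
Proof. by apply: continuousMC; [exact: continuous_ell|exact: continuous_cutoff]. Qed.

Let ell_cut_ge0 k z : 0 <= ell_cut k z.
Proof. by rewrite mulr_ge0 ?ell_ge0 ?cutoff_ge0. Qed.

Let ell_cut_le k z : ell_cut k z <= ell z.
Proof. by rewrite ler_piMr ?ell_ge0 ?cutoff_le1. Qed.

Lemma ell_le (r : R) z : modulus z <= r -> ell z <= ln (1 + r).
Proof.
move=> zr; rewrite ler_ln ?posrE ?onep_modulus_gt0 ?lerD2l//.
by rewrite (lt_le_trans (onep_modulus_gt0 z))// lerD2l.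
Qed.

Let ell_cut_bound k z : ell_cut k z <= ln (1 + k.+1%:R).
Proof.
have [zk|/ltW kz] := leP (modulus z) k.+1%:R.
  by rewrite (le_trans (ell_cut_le k z))// ell_le.
by rewrite /ell_cut cutoff0// mulr0 ln_ge0// lerDl.
Qed.

Let ell_cut_supp k : exists k' : nat, forall z, k'%:R <= modulus z -> ell_cut k z = 0.
Proof. by exists k.+1 => z kz; rewrite /ell_cut cutoff0// mulr0. Qed.

Let ell_cut_approx (c : \bar R) :
  (forall k, \int[mu]_z (ell_cut k z)%:E <= c)%E -> (\int[mu]_z (ell z)%:E <= c)%E.
Proof.
apply: (@integral_homo_le _ (borelC R) R mu (fun k z => (ell_cut k z)%:E)).
- by move=> k; apply: measurable_EFinC; exact: ell_cut_cont.
- by move=> k z; rewrite lee_fin.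
- by move=> z m n mn; rewrite lee_fin ler_wpM2l ?ell_ge0//; exact: cutoff_homo.
- move=> z; apply: cvg_near_cst; near=> k; rewrite /ell_cut.
  have -> : cutoff k z = 1 by near: k; exact: cutoff_near1.
  by rewrite mulr1.
Unshelve. all: by end_near. Qed.

(** A crude bound is enough for finiteness: l <= log (1 + r) inside the disk of radius r, and C is
    paid on the whole mass. *)
Lemma integral_ell_lty : (\int[mu]_z (ell z)%:E < +oo)%E.
Proof.
have E1 : E < E + 1 by rewrite ltrDl.
have [r r0 Hr] := tailE E1 0.
pose c := ln (1 + r) + C + (E + 1).
suff : (\int[mu]_z (ell z)%:E <= c%:E)%E by move=> h; rewrite (le_lt_trans h)// ltry.
apply: ell_cut_approx => k.
have Xc : liminf_le (fun n => avg (X n) (@ell R)) c.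
  move=> e e0 N; have [n Nn Xn] := Hr N; exists n => //.
  rewrite ler_wpDr ?(ltW e0)//.
  apply: (@le_trans _ _ (avg (X n) (fun x => (ln (1 + r) + C) +
    (if r <= modulus x then ell x - C else 0)))).
    apply: ler_avg => x _; case: ifPn => [_|].
      by rewrite -addrA [C + _]addrC subrK lerDr ln_ge0// lerDl.
    by rewrite -ltNge addr0 => xr; rewrite (le_trans (ell_le (ltW xr)))// lerDl.
  rewrite avgD lerD// avg_cst_le// addr_ge0// ln_ge0// lerDl//.
apply: (weakly_cvg_le Xmu (@ell_cut_cont k) (ell_cut_ge0 k) (ell_cut_bound k) (ell_cut_supp k) Xc).
by apply: nearW => n; exact: ler_avg.
Qed.

(** Tightness of the sequence: the integrals of the cutoffs against mu tend to its total mass 1, and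
    each one is the limit of the averages over [X n]. *)
Lemma cutoff_mass (e : R) : 0 < e ->
  exists k, \forall n \near \oo, avg (X n) (fun z => 1 - cutoff k z) <= e.
Proof.
move=> e0; have e2 : 0 < e / 2 by rewrite divr_gt0.
have fin k := @integral_fin_num R mu (cutoff k) 1 (@continuous_cutoff R k)
  (cutoff_ge0 k) (cutoff_le1 k).
have h : (\int[mu]_z (cutoff k z)%:E)%E @[k --> \oo] --> 1%:E.
  rewrite -[X in _ --> X](integral_cst_prob mu).
  apply: (@cvg_integral_homo _ (borelC R) R mu (fun k z => (cutoff k z)%:E)).
  - by move=> k; apply: measurable_EFinC; exact: continuous_cutoff.
  - by move=> k z; rewrite lee_fin cutoff_ge0.
  - by move=> z m n mn; rewrite lee_fin; exact: cutoff_homo.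
  - move=> z; apply: cvg_near_cst; near=> k.
    by congr EFin; near: k; exact: cutoff_near1.
move/fine_cvgP : h => [_ /cvgrPdist_le/(_ _ e2)[k _ /(_ k (leqnn k))]].
rewrite /= => hk; exists k.
have := Xmu (@continuous_cutoff R k) (cutoff_ge0 k)
  (ex_intro _ k.+1 (fun z => @cutoff0 R k z)).
rewrite -(fineK (fin k)) => /fine_cvgP[_ /cvgrPdist_le/(_ _ e2)].
apply: filterS => n /= hn; rewrite avgB.
have := avg_cst_le (X n) (@ler01 R).
by move: hk hn; rewrite !ler_norml => /andP[? ?] /andP[? ?]; lra.
Unshelve. all: by end_near. Qed.

(** Three errors of e / 3: the convergence of the integrals of l cut off beyond r, the tail of l -
    C, and C times the mass outside a large disk, small by tightness. *)
Lemma liminf_avg_ell :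
  liminf_le (fun n => avg (X n) (@ell R)) (fine (\int[mu]_z (ell z)%:E)%E + E).
Proof.
move=> e e0 N.
have fin : (\int[mu]_z (ell z)%:E)%E \is a fin_num.
  rewrite ge0_fin_numE ?integral_ell_lty// integral_ge0// => z _.
  by rewrite lee_fin ell_ge0.
set I := fine _.
have e3 : 0 < e / 3 by rewrite divr_gt0.
have eC : 0 < e / 3 / (C + 1) by rewrite divr_gt0// ltr_wpDl.
have [k hk] := cutoff_mass eC.
have E3 : E < E + e / 3 by rewrite ltrDl.
(* Because r >= k + 1, the function 1 - [cutoff k] is 1 wherever |x| >= r, so C times it makes up
   for the C subtracted in the tail. *)
have [r kr Hr] := tailE E3 k.+1%:R.
pose m := Num.truncn r.
have rm : r <= m.+1%:R by rewrite ltW// truncnS_gt.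
have : \forall n \near \oo, avg (X n) (ell_cut m.+1) <= I + e / 3.
  have finm := integral_fin_num mu (@ell_cut_cont m.+1) (ell_cut_ge0 m.+1) (ell_cut_bound m.+1).
  have := Xmu (@ell_cut_cont m.+1) (ell_cut_ge0 m.+1) (ell_cut_supp m.+1).
  rewrite -(fineK finm) => /fine_cvgP[_ h].
  apply: (cvgr_le _ h); rewrite (@le_lt_trans _ _ I)//; last by rewrite ltrDl.
  apply: fine_le => //; apply: ge0_le_integral => //.
  - by move=> z _; rewrite lee_fin.
  - by apply: measurable_EFinC; exact: ell_cut_cont.
  - by apply: measurable_EFinC; exact: continuous_ell.
  - by move=> z _; rewrite lee_fin.
move=> /(filterI hk)[M _ HM].
have [n] := Hr (maxn N M); rewrite geq_max => /andP[Nn Mn] hn.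
exists n => //; have [/= h1 h2] := HM n Mn.
apply: (@le_trans _ _ (avg (X n) (ell_cut m.+1)
   + avg (X n) (fun x => if r <= modulus x then ell x - C else 0)
   + C * avg (X n) (fun z => 1 - cutoff k z))).
  rewrite -avgZ -!avgD; apply: ler_avg => x _.
  have c0 : 0 <= C * (1 - cutoff k x) by rewrite mulr_ge0// subr_ge0 cutoff_le1.
  case: ifPn => rx.
    rewrite (cutoff0 (le_trans kr rx)) subr0 mulr1 -addrA subrK.
    by rewrite lerDr.
  rewrite addr0 /ell_cut cutoff1 ?mulr1 ?lerDl//.
  by rewrite -ltNge in rx; rewrite (le_trans (ltW rx)).
have h3 : C * avg (X n) (fun z => 1 - cutoff k z) <= e / 3.
  apply: le_trans (ler_wpM2l C0 h1) _.
  have -> : C * (e / 3 / (C + 1)) = e / 3 * (C / (C + 1)) by ring.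
  by rewrite ler_piMr ?(ltW e3)// ler_pdivrMr ?ltr_wpDl// mul1r lerDl.
by lra.
Qed.

End EllMass.

(** * Conjugates of an algebraic number *)

Section Conjugates.
Variable R : realType.
Implicit Types (a x : R[i]) (P Q : {poly int}).

Local Notation toC := (map_poly (intr : int -> R[i])).

Lemma modulus_intr (m : int) : modulus (m%:~R : R[i]) = `|m|%:~R.
Proof.
apply: complexI; transitivity `|m%:~R : R[i]|.
  by rewrite normc_def; case: (m%:~R : R[i]).
by rewrite -intr_norm rmorph_int.
Qed.

Lemma ln_modulus_prod (T : eqType) (s : seq T) (p : pred T) (f : T -> R[i]) :
  {in s, forall t, p t -> f t != 0} ->
  0 < modulus (\prod_(t <- s | p t) f t) /\
  ln (modulus (\prod_(t <- s | p t) f t)) = \sum_(t <- s | p t) ln (modulus (f t)).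
Proof.
elim: s => [|t s IH] fs.
  by rewrite !big_nil ComplexField.Normc.normc1 ln1.
have [|IH0 IH1] := IH; first by move=> y ys; apply: fs; rewrite inE ys orbT.
rewrite !big_cons; case: ifPn => // pt.
have ft0 : 0 < modulus (f t).
  by have := @modulusB_gt0 R (f t) 0 (fs t (mem_head _ _) pt); rewrite subr0.
rewrite ComplexField.Normc.normcM mulr_gt0//; split => //.
by rewrite lnM ?posrE// IH1.
Qed.

Lemma log_alead_ge0 a : 0 <= log_alead a.
Proof.
rewrite /log_alead; have [->|] := eqVneq (alead a) 0; first by rewrite normr0 ln0.
by move=> b0; rewrite ln_ge0// ler1z -gtz0_ge1 normr_gt0.
Qed.

(** A positive [adeg] excludes the default value 0 of [xget], so the choice has found a genuine
    minimal polynomial. *)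
Lemma intMinPoly_irreducible a : (0 < adeg a)%N -> irreducible_in_Zz (intMinPoly a).
Proof.
rewrite /adeg /intMinPoly; case: xgetP => [P -> [] //|_].
by rewrite size_poly0.
Qed.

Lemma conj_seq_uniq a : uniq (conj_seq a).
Proof. exact: finmap.fset_uniq. Qed.

Lemma conj_seqP (a : R[i]) : (0 < adeg a)%N ->
  [/\ (toC (intMinPoly a)) = (alead a)%:~R *: \prod_(x <- conj_seq a) ('X - x%:P),
      finite_set (Conj a) & size (conj_seq a) = adeg a].
Proof.
move=> a0; have Pirr := intMinPoly_irreducible a0.
have [rs rs_uniq PE] := irreducible_roots R[i] Pirr.
have P0 : intMinPoly a != 0 by case: Pirr.
have b0 : (alead a)%:~R != 0 :> R[i] by rewrite intr_eq0 lead_coef_eq0.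
have ConjE : Conj a = [set` rs].
  apply/seteqP; split=> x; rewrite /Conj /Croot /= PE rootZ// root_prod_XsubC//.
have fin : finite_set (Conj a) by rewrite ConjE; exact: finite_seq.
have prs : perm_eq (conj_seq a) rs.
  apply: uniq_perm => // [|x]; first exact: conj_seq_uniq.
  transitivity (x \in Conj a); first exact: (in_fset_set fin x).
  by rewrite ConjE mem_setE.
have PE' : (toC (intMinPoly a)) = (alead a)%:~R *: \prod_(x <- conj_seq a) ('X - x%:P).
  by rewrite PE; congr (_ *: _); apply/esym/perm_big.
split=> //; rewrite /adeg.
have := congr1 (fun p : {poly R[i]} => size p) PE'.
rewrite size_map_inj_poly//; last exact: intr_inj.
by rewrite size_scale// size_prod_XsubC => ->.
Qed.

Lemma mem_conj_seq a x : (0 < adeg a)%N -> x \in conj_seq a -> root (toC (intMinPoly a)) x.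
Proof.
move=> a0 xa; have [-> _ _] := conj_seqP a0.
rewrite rootZ ?root_prod_XsubC// intr_eq0 lead_coef_eq0.
by have [] := intMinPoly_irreducible a0.
Qed.

Lemma log_resultant_ge0 a Q : (0 < adeg a)%N ->
  {in conj_seq a, forall x, (toC Q).[x] != 0} ->
  0 <= (size Q).-1%:R * log_alead a + \sum_(x <- conj_seq a) ln (modulus (toC Q).[x]).
Proof.
move=> a0 Qx; have [PE _ _] := conj_seqP a0.
have [P0 _ _] := intMinPoly_irreducible a0.
have [m mE] := resultant_roots Q PE P0 (conj_seq_uniq a).
have [|pr0 prE] := @ln_modulus_prod _ (conj_seq a) predT (fun x => (toC Q).[x]).
  by move=> x /Qx.
have b0 : 0 < (`|alead a|%:~R : R) by rewrite ltr0z normr_gt0 lead_coef_eq0.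
have bq (k : nat) : modulus ((alead a)%:~R ^+ k : R[i]) = `|alead a|%:~R ^+ k.
  elim: k => [|k IH]; first by rewrite !expr0 ComplexField.Normc.normc1.
  by rewrite !exprS ComplexField.Normc.normcM IH modulus_intr.
have := congr1 (fun z : R[i] => modulus z) mE.
rewrite modulus_intr ComplexField.Normc.normcM bq => mE'.
have m1 : 1 <= (`|m|%:~R : R).
  rewrite ler1z -gtz0_ge1 -(ltr0z R) mE' mulr_gt0// exprn_gt0//.
have := ln_ge0 m1; rewrite mE' lnM ?posrE ?exprn_gt0// lnXn// prE.
by rewrite -[_ *+ _]mulr_natl.
Qed.

(** For a fixed [Q] this applies to all large n, because the degrees tend to infinity; it makes the
    resultant nonzero. *)
Lemma conj_no_common_root a Q : (0 < adeg a)%N -> Q != 0 ->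
  (size Q < size (intMinPoly a))%N -> {in conj_seq a, forall x, (toC Q).[x] != 0}.
Proof.
move=> a0 Q0 sQ x /(mem_conj_seq a0) Px; apply/negP => Qx.
have := irreducible_size_le (intMinPoly_irreducible a0) Q0 Px Qx.
by rewrite leqNgt sQ.
Qed.

(* The discriminant bound, read off the resultant of the minimal polynomial
   and its derivative. *)
Lemma log_discriminant_ge a : (0 < adeg a)%N ->
  - (2 * (adeg a)%:R * log_alead a) <=
  \sum_(x <- conj_seq a) \sum_(y <- conj_seq a | y != x) ln (modulus (x - y)).
Proof.
move=> a0; have [PE _ sa] := conj_seqP a0.
have [P0 _ _] := intMinPoly_irreducible a0.
have b0 : (alead a)%:~R != 0 :> R[i] by rewrite intr_eq0 lead_coef_eq0.
have dPE x : x \in conj_seq a -> (toC (intMinPoly a)^`()).[x]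
    = (alead a)%:~R * \prod_(y <- conj_seq a | y != x) (x - y).
  move=> xa; rewrite -deriv_map PE derivZ hornerZ; congr (_ * _).
  rewrite (bigD1_seq x) ?conj_seq_uniq//= derivM derivXsubC mul1r hornerD hornerM.
  rewrite hornerXsubC subrr mul0r addr0 horner_prod.
  by apply: eq_bigr => y _; rewrite hornerXsubC.
have dPx : {in conj_seq a, forall x, (toC (intMinPoly a)^`()).[x] != 0}.
  move=> x xa; rewrite dPE// mulf_neq0// prodf_seq_neq0; apply/allP => y ya.
  by apply/implyP => yx; rewrite subr_eq0 eq_sym.
have dPln x : x \in conj_seq a -> ln (modulus (toC (intMinPoly a)^`()).[x])
    = log_alead a + \sum_(y <- conj_seq a | y != x) ln (modulus (x - y)).
  move=> xa; rewrite dPE// ComplexField.Normc.normcM modulus_intr.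
  have [y _ yx|pr0 prE] := @ln_modulus_prod _ (conj_seq a) (fun y => y != x) (fun y => x - y).
    by rewrite subr_eq0 eq_sym.
  by rewrite lnM ?posrE// ?prE// ltr0z normr_gt0 lead_coef_eq0.
have := log_resultant_ge0 a0 dPx.
rewrite [X in _ + X](_ : _ = (adeg a)%:R * log_alead a +
  \sum_(x <- conj_seq a) \sum_(y <- conj_seq a | y != x) ln (modulus (x - y))); last first.
  transitivity (\sum_(x <- conj_seq a) (log_alead a +
      \sum_(y <- conj_seq a | y != x) ln (modulus (x - y)))).
    by rewrite big_seq [RHS]big_seq; apply: eq_bigr => x /dPln.
  by rewrite big_split/= big_const_seq count_predT iter_addr addr0 sa mulr_natl.
(* The power of the leading coefficient in the resultant gives one [adeg a], the degree of the
   derivative being rounded up; the leading coefficient in each value of the derivative gives the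
   other. *)
have : (size (intMinPoly a)^`()).-1%:R * log_alead a <= (adeg a)%:R * log_alead a.
  rewrite ler_wpM2r ?log_alead_ge0// ler_nat /adeg.
  by have := lt_size_deriv P0; lia.
by lra.
Qed.

End Conjugates.

(** * The limit measure *)

Section ConjMeasure.
Variable R : realType.

Lemma integral_conj_measure (a : R[i]) (f : R[i] -> R) : (0 < adeg a)%N ->
  continuous f -> (forall z, 0 <= f z) ->
  (\int[conj_measure a]_z (f z)%:E)%E = (avg (conj_seq a) f)%:E.
Proof.
move=> a0 cf f0; have [_ _ sa] := conj_seqP a0.
have mf := measurable_EFinC cf.
have f0' (z : borelC R) : [set: borelC R] z -> (0 <= (f z)%:E)%E.
  by move=> _; rewrite lee_fin.
rewrite /conj_measure ge0_integral_mscale// ge0_integral_measure_sum//.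
under eq_bigr do rewrite integral_dirac// diracT mul1e.
rewrite sumEFin -EFinM /avg sa /=; congr (_ * _)%:E.
by rewrite [RHS](big_nth 0) big_mkord sa.
Qed.

Lemma weakly_cvg_conj_seq (alpha : nat -> R[i]) (mu : probability (borelC R) R) :
  adeg (alpha n) @[n --> \oo] --> \oo ->
  weak_star_cvg (fun n => conj_measure (alpha n)) mu ->
  weakly_cvg (fun n => conj_seq (alpha n)) mu.
Proof.
move=> deg_infty mu_cvg f cf f0 [k fk].
have h : (\int[conj_measure (alpha n)]_z (f z)%:E)%E @[n --> \oo] -->
    (\int[mu]_z (f z)%:E)%E.
  apply: mu_cvg => //.
  apply: (@subclosed_compact _ _ [set z : R[i] | modulus z <= k%:R]).
  - exact: closed_closure.
  - exact: compact_disk.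
  -
  have /closure_id cd := @closed_disk R k%:R; rewrite cd.
  apply: closure_subset => z /= fz; rewrite leNgt; apply: contra fz => /ltW kz.
  by rewrite fk.
apply: cvg_trans h; apply: near_eq_cvg.
move/cvgnyPgt: deg_infty => /(_ 0%N); apply: filterS => n n0; by rewrite integral_conj_measure.
Qed.

End ConjMeasure.

(** * The chordal form of the logarithm of a polynomial *)

Section PolynomialKernel.
Variable R : realType.
Implicit Types (z : R[i]) (rs : seq R[i]).

Definition chordal_prod rs z : R := \prod_(x <- rs) chordal z x.

Lemma chordal_prod_ge0 rs z : 0 <= chordal_prod rs z.
Proof. by apply: prodr_ge0 => x _; exact: chordal_ge0. Qed.

Lemma chordal_prod_le1 rs z : chordal_prod rs z <= 1.
Proof.
elim: rs => [|x rs IH]; first by rewrite /chordal_prod big_nil.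
by rewrite /chordal_prod big_cons mulr_ile1 ?chordal_ge0 ?chordal_le1 ?chordal_prod_ge0.
Qed.

Lemma continuous_chordal_prod rs : continuous (chordal_prod rs).
Proof.
elim: rs => [|x rs IH].
  rewrite (_ : chordal_prod [::] = cst 1); first exact: cst_continuous.
  by apply/funext => z; rewrite /chordal_prod big_nil.
rewrite (_ : chordal_prod _ = fun z => chordal z x * chordal_prod rs z).
  apply: continuousMC => //.
  by apply: (@lipschitz_continuousC _ _ 2) => z w; exact: chordal_lip.
by apply/funext => z; rewrite /chordal_prod big_cons.
Qed.

Lemma ln_chordal_prod rs z : z \notin rs -> 0 < chordal_prod rs z /\
  - ln (chordal_prod rs z) = (size rs)%:R * ell z + \sum_(x <- rs) ell x
    - \sum_(x <- rs) ln (modulus (z - x)).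
Proof.
elim: rs => [|x rs IH].
  by rewrite /chordal_prod !big_nil ln1 mul0r addr0 subrr oppr0.
rewrite inE negb_or => /andP[zx /IH[p0 pE]].
have c0 := chordal_gt0 zx.
rewrite /chordal_prod !big_cons -/(chordal_prod rs z); split; first exact: mulr_gt0.
rewrite lnM ?posrE// opprD pE ln_chordal//=.
by rewrite -natr1 mulrDl mul1r; ring.
Qed.

(** At a root both sides are -oo, so the identity holds on the whole plane; repeated roots are
    counted in [rs] with multiplicity. *)
Lemma logmod_chordal_prod (l : R[i]) rs z : l != 0 ->
  logmod (l *: \prod_(x <- rs) ('X - x%:P)).[z] =
  (((size rs)%:R * ell z + (\sum_(x <- rs) ell x + ln (modulus l)))%:E
   - (- lne (chordal_prod rs z)%:E))%E.
Proof.
move=> l0; rewrite hornerZ horner_prod; under eq_bigr do rewrite hornerXsubC.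
have ml : 0 < modulus l by have := modulusB_gt0 l0; rewrite subr0.
have [zrs|zrs] := boolP (z \in rs).
  have -> : chordal_prod rs z = 0.
    rewrite /chordal_prod (big_rem z)//= {1}/chordal subrr.
    by rewrite ComplexField.Normc.normc0 !mul0r.
  rewrite (big_rem z)//= subrr mul0r mulr0 /logmod ComplexField.Normc.normc0.
  by rewrite /= lexx.
have [p0 pE] := ln_chordal_prod zrs.
have [|pr0 prE] := @ln_modulus_prod R _ rs predT (fun x => z - x).
  by move=> x xrs _; rewrite subr_eq0; apply: contraNneq zrs => ->.
rewrite /logmod ComplexField.Normc.normcM !lne_EFin ?mulr_gt0//.
rewrite -!EFinN -EFinB; congr EFin.
by rewrite lnM ?posrE// prE pE /=; ring.
Qed.

Lemma measurable_neglog (u : R[i] -> R) : continuous u -> (forall z, 0 <= u z) ->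
  measurable_fun [set: borelC R] (fun z : borelC R => (- lne (u z)%:E)%E).
Proof.
move=> cu u0.
apply: (@measurable_homo _ (borelC R) R (fun k z => (tlog k (u z) * 1)%:E)).
- move=> k; apply: measurable_EFinC; apply: continuousMC; first exact: continuous_tlog.
  exact: cst_continuous.
- by move=> z; apply: (@cvg_tlog _ _ (fun=> 1)) => //; exact: nearW.
Qed.

End PolynomialKernel.

(** * Both inequalities when the escape rate is finite *)

Section LimitMeasure.
Variable R : realType.
Variables (alpha : nat -> R[i]) (mu : probability (borelC R) R) (L E : R).
Hypothesis deg_infty : adeg (alpha n) @[n --> \oo] --> \oo.
Hypothesis lead_cvg : log_alead (alpha n) / (adeg (alpha n))%:R @[n --> \oo] --> L.
Let X n := conj_seq (alpha n).
Hypothesis Xmu : weakly_cvg X mu.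
Hypothesis ell_fin : (\int[mu]_z (ell z)%:E < +oo)%E.
Let I := fine (\int[mu]_z (ell z)%:E)%E.
Hypothesis ell_liminf : liminf_le (fun n => avg (X n) (@ell R)) (I + E).

Let IE : (\int[mu]_z (ell z)%:E)%E = I%:E.
Proof.
by rewrite fineK// ge0_fin_numE// integral_ge0// => z _; rewrite lee_fin ell_ge0.
Qed.

Let deg_ge (N : nat) : \forall n \near \oo, (N < adeg (alpha n))%N.
Proof. by move/cvgnyPgt: deg_infty => /(_ N). Qed.

(** The resultant bounds the integral of - log of the chordal product by q (I + E) + c + q L. The
    integral of log |Q| is q I + c minus that integral, so q I and c cancel and - q (L + E) is
    left. *)
Lemma integral_logmod_poly_ge (Q : {poly int}) : (1 < size Q)%N ->
  ((- L%:E - E%:E) <= ((size Q).-1%:R^-1)%:E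
     * \int[mu]_z logmod (map_poly (intr : int -> R[i]) Q).[z])%E.
Proof.
move=> sQ.
have Q0 : Q != 0 by rewrite -size_poly_gt0 ltnW.
pose q : R := (size Q).-1%:R.
have q0 : 0 < q by rewrite ltr0n -subn1 subn_gt0.
have [rs rsE] := closed_field_poly_normal (map_poly (intr : int -> R[i]) Q).
pose l : R[i] := (lead_coef Q)%:~R.
have lE : lead_coef (map_poly (intr : int -> R[i]) Q) = l.
  by rewrite lead_coef_map_inj//; exact: intr_inj.
rewrite lE in rsE.
have l0 : l != 0 by rewrite intr_eq0 lead_coef_eq0.
have srs : (size rs)%:R = q.
  have := congr1 (fun p : {poly R[i]} => size p) rsE.
  rewrite size_map_inj_poly//; last exact: intr_inj.
  by rewrite size_scale// size_prod_XsubC /q => ->.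
pose c := \sum_(x <- rs) ell x + ln (modulus l).
have c0 : 0 <= c.
  rewrite addr_ge0//; first by apply: sumr_ge0 => x _; exact: ell_ge0.
  by rewrite modulus_intr ln_ge0// ler1z -gtz0_ge1 normr_gt0 lead_coef_eq0.
have logE z : logmod (map_poly (intr : int -> R[i]) Q).[z]
    = ((q * ell z + c)%:E - (- lne (chordal_prod rs z)%:E))%E.
  by rewrite rsE logmod_chordal_prod// srs.
have ellm : measurable_fun [set: borelC R] (fun z : borelC R => q * ell z).
  apply: continuous_measurableC; apply: continuousMC; first exact: cst_continuous.
  exact: continuous_ell.
have qI : (\int[mu]_z (q * ell z + c)%:E = (q * I + c)%:E)%E.
  under eq_integral do rewrite EFinD.
  rewrite ge0_integralD ?integral_cst_prob//.
  - under eq_integral do rewrite EFinM.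
    rewrite ge0_integralZl_EFin ?(ltW q0)//.
    + by rewrite IE -EFinM -EFinD.
    + by move=> z _; rewrite lee_fin ell_ge0.
    + by apply: measurable_EFinC; exact: continuous_ell.
  - by move=> z _; rewrite lee_fin mulr_ge0 ?ell_ge0// ltW.
  - exact/measurable_EFinP.
have Xc : liminf_le (fun n => avg (X n) (fun x => - ln (chordal_prod rs x)))
    (q * (I + E) + (c + q * L)).
  apply: (liminf_le_affine (s := fun n => c + q * (log_alead (alpha n) / (adeg (alpha n))%:R))
    (ltW q0) ell_liminf).
    by apply: cvgD; [exact: cvg_cst|apply: cvgM => //; exact: cvg_cst].
  apply: filterS (deg_ge (size Q)) => n nQ.
  have a0 : (0 < adeg (alpha n))%N by rewrite (leq_ltn_trans _ nQ).
  have [_ _ sa] := conj_seqP a0.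
  have Qx : {in X n, forall x, (map_poly (intr : int -> R[i]) Q).[x] != 0}.
    apply: conj_no_common_root => //; apply: leq_trans nQ _.
    by rewrite /adeg leq_pred.
  have -> : avg (X n) (fun x => - ln (chordal_prod rs x)) = avg (X n) (fun x =>
      q * ell x + c - ln (modulus (map_poly (intr : int -> R[i]) Q).[x])).
    apply: eq_avg => x /Qx Qx0.
    have xrs : x \notin rs.
      apply: contra Qx0 => xrs; rewrite rsE -[_ == 0]/(root _ x) rootZ//.
      by rewrite root_prod_XsubC.
    have := logE x; have [p0 _] := ln_chordal_prod xrs.
    rewrite /logmod !lne_EFin//; last first.
      by have := modulusB_gt0 Qx0; rewrite subr0.
    by rewrite -EFinN -EFinB => -[->]; ring.
  rewrite avgB avgD avgZ -addrA lerD2l.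
  rewrite lerD ?avg_cst_le// lerNl -mulrN /avg sa.
  have := log_resultant_ge0 a0 Qx; rewrite -/q => h.
  have d0 : 0 < (adeg (alpha n))%:R^-1 :> R by rewrite invr_gt0 ltr0n.
  have := mulr_ge0 (ltW d0) h; rewrite mulrDr => h'.
  rewrite -subr_ge0; apply: le_trans h' _; rewrite /X.
  by rewrite le_eqVlt; apply/orP; left; apply/eqP; ring.
have := integral_neglog_le Xmu (@continuous_chordal_prod R rs)
  (chordal_prod_ge0 rs) (chordal_prod_le1 rs) _ Xc.
have Xpos : \forall n \near \oo, {in X n, forall x, 0 < chordal_prod rs x}.
  apply: filterS (deg_ge (size Q)) => n nQ x xX.
  have a0 : (0 < adeg (alpha n))%N by rewrite (leq_ltn_trans _ nQ).
  have Qx0 : (map_poly (intr : int -> R[i]) Q).[x] != 0.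
    apply: (conj_no_common_root a0 Q0 _ xX); apply: leq_trans nQ _.
    by rewrite /adeg leq_pred.
  apply: (ln_chordal_prod _).1.
  apply: contra Qx0 => xrs; rewrite rsE -[_ == 0]/(root _ x) rootZ//.
  by rewrite root_prod_XsubC.
move=> /(_ Xpos) hU.
under eq_integral do rewrite logE.
rewrite (@integral_EFin_subr _ (borelC R) R mu
  (fun z => (- lne (chordal_prod rs z)%:E)%E) (fun z => q * ell z + c)).
- rewrite qI -EFinN -EFinB.
  have -> : (- L - E) = q^-1 * (- (q * (L + E))).
    by rewrite mulrN mulKf ?gt_eqF// opprD.
  rewrite EFinM lee_wpmul2l ?lee_fin ?invr_ge0 ?(ltW q0)//.
  have -> : - (q * (L + E)) = (q * I + c) - (q * (I + E) + (c + q * L)) by ring.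
  by rewrite EFinB leeB.
- apply: measurable_neglog; first exact: continuous_chordal_prod.
  by move=> z; exact: chordal_prod_ge0.
- by move=> z; rewrite oppe_ge0 lne_le0 lee_fin chordal_prod_le1.
- exact: measurable_funD.
- by move=> z; rewrite addr_ge0// mulr_ge0 ?ell_ge0// ltW.
- by rewrite qI ltry.
Qed.

(** Along one subsequence the terms l(z) and l(w) of - log u contribute at most I + E each and the
    discriminant at most 2 L; subtracting 2 I leaves 2 (L + E). *)
Lemma log_energy_limit_le : (log_energy mu <= 2%:E * (L%:E + E%:E))%E.
Proof.
rewrite log_energyE// IE.
have Xc : liminf_le (fun n => avg (X n) (fun z => avg (X n)
    (fun w => if w == z then 0 else - ln (chordal z w)))) (2 * (I + E) + 2 * L).
  apply: (liminf_le_affine (s := fun n => 2 * (log_alead (alpha n) / (adeg (alpha n))%:R))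
    (ler0n R 2) ell_liminf).
    by apply: cvgM => //; exact: cvg_cst.
  apply: filterS (deg_ge 0) => n a0.
  have [_ _ sa] := conj_seqP a0.
  have d0 : 0 < (adeg (alpha n))%:R^-1 :> R by rewrite invr_gt0 ltr0n.
  set d : R := (adeg (alpha n))%:R^-1 in d0 *.
  have X0 : X n != [::] by rewrite -size_eq0 sa -lt0n.
  have inner z : z \in X n -> avg (X n) (fun w => if w == z then 0 else - ln (chordal z w))
      <= ell z + avg (X n) (@ell R) - d * \sum_(w <- X n | w != z) ln (modulus (z - w)).
    move=> zX; rewrite -[ell z](avg_cst _ X0) -avgD /avg sa -/d -mulrBr.
    rewrite ler_wpM2l ?(ltW d0)// lerBrDr [X in _ + X]big_mkcond -big_split/=.
    rewrite big_seq [leRHS]big_seq; apply: ler_sum => w wX.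
    (* Off the diagonal this is an equality; at w = z the left side is 0 and the right side
       nonnegative. *)
    case: eqP => [->|/eqP wz] /=; first by rewrite addr0 addr_ge0 ?ell_ge0.
    by rewrite ln_chordal 1?eq_sym// subrK.
  apply: (le_trans (ler_avg inner)).
  rewrite avgB avgD (avg_cst _ X0) avgZ.
  rewrite [2 * avg _ _]mulrC mulr_natr mulr2n lerD2l /avg sa -/d.
  have := log_discriminant_ge a0 => h.
  have := ler_wpM2l (ltW (mulr_gt0 d0 d0)) h.
  have dd : d * (adeg (alpha n))%:R = 1 by rewrite mulVf// pnatr_eq0 -lt0n.
  have ddN (c N l : R) : c * N = 1 -> c * c * - (2 * N * l) = - (2 * (l * c)).
    move=> cN; transitivity (- (2 * (l * c)) * (c * N)); first by ring.
    by rewrite cN mulr1.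
  rewrite (ddN _ _ _ dd).
  by move=> h'; rewrite lerNl [leRHS]mulrA.
have Xsize : (size (X n))%:R^-1 @[n --> \oo] --> (0 : R).
  apply/cvgrPdist_le => e e0.
  apply: filterS (deg_ge (Num.truncn e^-1)) => n nN.
  have a0 : (0 < adeg (alpha n))%N by rewrite (leq_ltn_trans _ nN).
  have [_ _ sa] := conj_seqP a0.
  rewrite sub0r normrN ger0_norm ?invr_ge0// sa.
  rewrite -[leRHS]invrK lef_pV2 ?posrE ?invr_gt0 ?ltr0n//.
  by rewrite (le_trans (ltW (truncnS_gt _)))// ler_nat.
have h := chordal_energy_le Xmu (fun n => conj_seq_uniq (alpha n)) Xsize Xc.
rewrite -EFinM -EFinD -EFinM.
have -> : 2 * (L + E) = (2 * (I + E) + 2 * L) - 2 * I by ring.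
by rewrite EFinB leeB.
Qed.

End LimitMeasure.

(** * The escape rate as a bound on tails *)

Section EscapeRate.
Variable R : realType.
Implicit Types (Sigma : set R[i]) (b : nat -> R[i]).

Definition escape_term Sigma (a : R[i]) (r : R) : \bar R :=
  (((adeg a)%:R^-1)%:E *
     \sum_(x \in Conj a `&` [set x | (r <= modulus x)%R]) green Sigma x)%E.

Lemma escape_termE Sigma (a : R[i]) (r : R) : (0 < adeg a)%N ->
  escape_term Sigma a r = (((adeg a)%:R^-1)%:E *
    \sum_(x <- conj_seq a) (if (r <= modulus x)%R then green Sigma x else 0))%E.
Proof.
move=> a0; have [_ fin _] := conj_seqP a0.
rewrite /escape_term fsbig_mkcondr fsbig_finite//; congr (_ * _)%E.
by apply: eq_bigr => x _; rewrite mem_setE.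
Qed.

Variables (Sigma : set R[i]) (b : nat -> R[i]) (r0 C : R).
Hypothesis C0 : 0 <= C.
Hypothesis deg_infty : adeg (b n) @[n --> \oo] --> \oo.
Hypothesis gC : forall z, r0 <= modulus z -> ((ell z - C)%:E <= green Sigma z)%E.

Let f r := limn_einf (fun n => escape_term Sigma (b n) r).
(** From radius e^C on, l >= C, so that the lower bound l - C makes the Green function nonnegative
    beyond [r1]. *)
Let r1 := Num.max r0 (expR C).

Let green_ge0 z : r1 <= modulus z -> (0 <= green Sigma z)%E.
Proof.
rewrite ge_max => /andP[/gC g Cz]; apply: le_trans g; rewrite lee_fin subr_ge0.
rewrite -[leLHS]expRK ler_ln ?posrE ?expR_gt0 ?onep_modulus_gt0//.
by rewrite (le_trans Cz)// lerDr.
Qed.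

Let escape_term0 a r : adeg a = 0%N -> escape_term Sigma a r = 0%E.
Proof. by move=> a0; rewrite /escape_term a0 invr0 mul0e. Qed.

Let escape_term_ge0 a r : r1 <= r -> (0 <= escape_term Sigma a r)%E.
Proof.
move=> r1r; have [/escape_term0->//|a0] := posnP (adeg a).
rewrite escape_termE// mule_ge0 ?lee_fin ?invr_ge0//.
by apply: sume_ge0 => x _; case: ifPn => // rx; apply: green_ge0; exact: le_trans rx.
Qed.

Let escape_term_dec a r s : r1 <= r -> r <= s ->
  (escape_term Sigma a s <= escape_term Sigma a r)%E.
Proof.
move=> r1r rs; have [a0|a0] := posnP (adeg a); first by rewrite !escape_term0.
rewrite !escape_termE// lee_wpmul2l ?lee_fin ?invr_ge0//.
apply: lee_sum => x _; case: ifPn => sx; first by rewrite (le_trans rs sx).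
by case: ifPn => // rx; apply: green_ge0; exact: le_trans rx.
Qed.

(** [lim] is meaningful only if the limit exists, and it does because the lower limits decrease in r
    beyond [r1]. Since [cvg] means convergence to [lim], the escape rate is the limit. *)
Lemma cvg_escape_rate : f r @[r --> +oo] --> escape_rate Sigma b.
Proof.
have : cvg (f r @[r --> +oo]).
  apply: (@nonincreasing_near_cvge _ f r1) => r s r1r rs.
  by apply: le_limn_einf => n; exact: escape_term_dec.
by [].
Qed.

(** This excludes the value -oo, so that the escape rate is either real or +oo. *)
Lemma escape_rate_ge0 : (0 <= escape_rate Sigma b)%E.
Proof.
have h := cvg_escape_rate; rewrite -(cvg_lim _ h)//; apply: lime_ge.
  by apply/cvg_ex; exists (escape_rate Sigma b).
near=> r; apply: (@limn_einf_ge _ _ _ 0%N) => n _; apply: escape_term_ge0.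
by near: r; apply: nbhs_pinfty_ge; exact: num_real.
Unshelve. all: by end_near. Qed.

(** Supplies [tailE]: for large r the lower limit over n is below t, hence so are infinitely many
    terms, in which l - C then replaces the larger Green function. *)
Lemma escape_rate_tail (E : R) : escape_rate Sigma b = E%:E ->
  forall t, E < t -> forall r', exists2 r, r' <= r &
  forall N, exists2 n, (N <= n)%N &
    avg (conj_seq (b n)) (fun x => if r <= modulus x then ell x - C else 0) <= t.
Proof.
move=> EE t Et r'; have := cvg_escape_rate; rewrite EE => /fine_cvgP[ffin fE].
have ft : \forall r \near +oo, fine (f r) < t by exact: (cvgr_lt _ fE).
have rr : \forall r \near +oo, Num.max r' r0 <= r.
  by apply: nbhs_pinfty_ge; exact: num_real.
have [r [[rfin rt] rmax]] := filter_ex (filterI (filterI ffin ft) rr).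
move: rmax; rewrite ge_max => /andP[r'r r0r]; exists r => // N.
have frt : (f r < t%:E)%E by rewrite -(fineK rfin) lte_fin.
have [M _ HM] : \forall n \near \oo, (0 < adeg (b n))%N.
  by move/cvgnyPgt: deg_infty => /(_ 0%N).
have [n] := limn_einf_lt frt (maxn N M).
rewrite geq_max => /andP[Nn Mn] hn; exists n => //.
have a0 := HM n Mn; have [_ _ sa] := conj_seqP a0.
rewrite -lee_fin; apply: le_trans (ltW hn); rewrite escape_termE//.
rewrite /avg sa EFinM lee_wpmul2l ?lee_fin ?invr_ge0//.
rewrite -sumEFin; apply: lee_sum => x _; case: ifPn => // rx.
by apply: gC; exact: le_trans rx.
Qed.

End EscapeRate.

Theorem theorem1p4 (R : realType) (Sigma : set R[i])
    (Sigma_compact : compact Sigma)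
    (Sigma_sym : forall z : R[i], Sigma z -> Sigma (conjc z))
    (Sigma_cap : (0 < capacity Sigma)%E)
    (alpha : nat -> R[i])
    (alpha_alg : forall n, algebraic_number (alpha n))
    (deg_infty : adeg (alpha n) @[n --> \oo] --> \oo)
    (height_cvg : exists h : R, height Sigma (alpha n) @[n --> \oo] --> h%:E)
    (lead_cvg : cvgn (fun n => log_alead (alpha n) / (adeg (alpha n))%:R : R))
    (mu : probability (borelC R) R)
    (mu_cvg : weak_star_cvg (fun n => conj_measure (alpha n)) mu) :
  let L : R := limn (fun n => log_alead (alpha n) / (adeg (alpha n))%:R : R) in
  (forall Q : {poly int}, (1 < size Q)%N ->
     (((size Q).-1%:R^-1)%:E
        * \int[mu]_z logmod (map_poly (intr : int -> R[i]) Q).[z]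
      >= - L%:E - escape_rate Sigma alpha)%E)
  /\ (log_energy mu <= 2%:E * (L%:E + escape_rate Sigma alpha))%E.
Proof.
move=> L.
have Xmu := weakly_cvg_conj_seq deg_infty mu_cvg.
have [r0 [C [C0 gC]]] := green_ge Sigma_compact.
have := @escape_rate_ge0 R Sigma alpha r0 C gC.
case EE : (escape_rate Sigma alpha) => [E| |] // _; last first.
  split=> [Q _|]; first by rewrite /= leNye.
  by rewrite addey// gt0_muley ?lte_fin// leey.
have tailE := escape_rate_tail deg_infty gC EE.
have ell_fin := integral_ell_lty Xmu C0 tailE.
have ell_liminf := liminf_avg_ell Xmu C0 tailE.
split=> [Q sQ|].
  exact: (integral_logmod_poly_ge deg_infty lead_cvg Xmu ell_fin ell_liminf sQ).
exact: (log_energy_limit_le deg_infty lead_cvg Xmu ell_fin ell_liminf).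
Qed.
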